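(* Let $A=(a_1,\ldots,a_q)\in\mathbb{R}^q$ and $B=(b_1,\ldots,b_q)\in\mathbb{R}^q$, and put $v(t)=\sum_{j=1}^{q}(t^{a_j}-t^{b_j})$. Suppose $v(t)\ge 0$ on $(0,1]$ and $\sigma>0$. Then the functions $$x\mapsto {}_{q+1}F_q(\sigma,A;B;-x)\qquad\text{and}\qquad x\mapsto {}_{q}F_q(A;B;-x)$$ are completely monotone on $(0,\infty)$. In particular, this holds if $B\prec^W A$.
   Context: ${}_pF_q(A;B;z)=\sum_{n\ge 0}\frac{(a_1)_n\cdots(a_p)_n}{(b_1)_n\cdots(b_q)_n\,n!}z^n$, where $b_j\notin\{0,-1,-2,\ldots\}$ and $(a)_0=1$, $(a)_n=a(a+1)\cdots(a+n-1)$ for $n\ge1$; the series converges for all $z\in\mathbb{C}$ if $p\le q$ and for $|z|<1$ if $p=q+1$, and in the latter case ${}_{q+1}F_q$ denotes the holomorphic extension to $\mathbb{C}\setminus[1,\infty)$. In ${}_{q+1}F_q(\sigma,A;B;z)$ the upper parameters are $\sigma,a_1,\ldots,a_q$. A nonnegative function $f$ on $(0,\infty)$ is called completely monotone if it has derivatives of all orders and $(-1)^nf^{(n)}(x)\ge0$ for all integers $n\ge0$ and all $x>0$. Weak supermajorization $B\prec^W A$ (with $A$, $B$ each arranged in ascending order) means: $0<a_1\le a_2\le\cdots\le a_q$, $0<b_1\le b_2\le\cdots\le b_q$ and $\sum_{i=1}^{k}a_i\le\sum_{i=1}^{k}b_i$ for $k=1,2,\ldots,q$.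
   Formalization: The first claim is stated for a_j ≥ 0 and b_j not in {0,−1,−2,…}; for arbitrary real A it fails, e.g. q=1, a=−1/2, b=1/2, where v ≥ 0 on (0,1] but 1F1(−1/2;1/2;−x)=1+x+… increases near 0. *)

(* Defs.v *)
From Stdlib Require Import Reals Factorial List Permutation Sorted.
From Coquelicot Require Import Coquelicot.
Import ListNotations.
Open Scope R_scope.

Fixpoint poch (a : R) (n : nat) : R :=
  match n with
  | O => 1
  | S m => poch a m * (a + INR m)
  end.

Definition Rlist_sum (l : list R) : R := fold_right Rplus 0 l.
Definition Rlist_prod (l : list R) : R := fold_right Rmult 1 l.

Definition hyp_coef (A B : list R) (n : nat) : R :=
  Rlist_prod (map (fun a => poch a n) A)
  / (Rlist_prod (map (fun b => poch b n) B) * INR (fact n)).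

Definition is_hyp_series (A B : list R) (z l : C) : Prop :=
  @is_pseries C_AbsRing C_NormedModule (fun n => RtoC (hyp_coef A B n)) z l.

Definition slit_plane (z : C) : Prop := ~ (Im z = 0 /\ 1 <= Re z).

(* [is_pFq A B F]: F is the function pFq(A; B; -), with p and q the lengths of
   A and B.  It is the sum of the series on C when p <= q, and the holomorphic
   extension of that sum to C \ [1, oo) when p = q + 1; by the identity theorem
   this determines F on C, resp. on C \ [1, oo). *)
Definition is_pFq (A B : list R) (F : C -> C) : Prop :=
  ((length A <= length B)%nat /\ forall z : C, is_hyp_series A B z (F z))
  \/
  (length A = S (length B) /\
   (forall z : C, Cmod z < 1 -> is_hyp_series A B z (F z)) /\
   (forall z : C, slit_plane z -> @ex_derive C_AbsRing C_NormedModule F z)).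

(* On (0, oo): the values of f elsewhere are irrelevant. *)
Definition completely_monotone (f : R -> R) : Prop :=
  forall (n : nat) (x : R), 0 < x ->
    ex_derive_n f n x /\ 0 <= (-1) ^ n * Derive_n f n x.

(* The function F = pFq(A; B; -) exists, and the restriction of F(-x) to x > 0
   is real valued and completely monotone. *)
Definition pFq_neg_completely_monotone (A B : list R) : Prop :=
  exists (F : C -> C) (f : R -> R),
    is_pFq A B F /\
    (forall x : R, 0 < x -> F (RtoC (- x)) = RtoC (f x)) /\
    completely_monotone f.

Definition vfun (A B : list R) (t : R) : R :=
  Rlist_sum
    (map (fun p => Rpower t (fst p) - Rpower t (snd p)) (combine A B)).

(* [weak_supermajorization B A] is B <^W A; A' and B' are the ascending
   rearrangements of A and B. *)
Definition weak_supermajorization (B A : list R) : Prop :=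
  length A = length B /\
  exists A' B' : list R,
    Permutation A A' /\ Sorted Rle A' /\ List.Forall (fun a => 0 < a) A' /\
    Permutation B B' /\ Sorted Rle B' /\ List.Forall (fun b => 0 < b) B' /\
    forall k : nat, (1 <= k <= length A)%nat ->
      Rlist_sum (firstn k A') <= Rlist_sum (firstn k B').

(* Main.v *)
Require Import Defs.
From Stdlib Require Import Reals Factorial List Lra Lia Psatz Permutation Sorted.
From Coquelicot Require Import Coquelicot.
Open Scope R_scope.

(** Since [ln (b+x) - ln (a+x)] has derivative [1/(b+x) - 1/(a+x)] and
    [1/(a+x) - 1/(b+x)] is the integral of [(t^a - t^b) t^(x-1)] over [0,1], the condition
    [v >= 0] makes [g(n) = sum_j ln ((b_j+n)/(a_j+n))] a Hausdorff moment sequence, hence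
    also [exp g].  As [exp (g n) = m_n / m_(n+1)] for [m_n = (A)_n / (B)_n], the sequence
    [m] is a limit of products of shifts of [exp g] and is itself a Hausdorff moment
    sequence.  Writing [L] for the positive functional on functions on [0,1] with
    [L(t^n) = m_n] (a limit of Bernstein sums), the two hypergeometric functions at [-x] are
    [L((1+xt)^(-sigma))] and [L(exp(-xt))], which are completely monotone; and
    [z |-> L((1-zt)^(-sigma))] is the holomorphic extension to the slit plane.  The
    condition [v >= 0] forces [b_j > 0], and if some [a_j = 0] then [m] is the indicator
    of [0]. *)

(** * Hausdorff moment sequences *)

(** The hypothesis on [v] concerns the sum over [j], so the single quotients [(a_j)_n / (b_j)_n]
    need not be Hausdorff sequences; the logarithm is taken because it turns their product into a
    sum in which [v] enters linearly. No representing measure is ever constructed. The sign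
    conditions on differences replace it, and [L] is applied only to functions on [0,1] with a
    uniform quadratic Taylor remainder. For these, consecutive Bernstein sums differ by O(1/N^2), so
    their limit exists. The only analytic tool for [L] is the bound [|L(phi)| <= m_0 sup |phi|]. It
    carries a quadratic remainder in a parameter through [L], so second-order estimates do the work
    of dominated convergence, for the real variable [x] as well as for the complex variable [z]. As
    the extension has to be exhibited on the whole slit plane, an explicit complex power is needed;
    [L] is only real-linear, hence the constant splitting into real and imaginary parts. *)

Fixpoint diff (k : nat) (m : nat -> R) (n : nat) : R :=
  match k with
  | O => m n
  | S j => diff j (fun i => m i - m (S i)) n
  end.

(** For moments of a positive measure on [0,1] these differences are the integrals of [t^n (1-t)^k]
    (see [diff_pow]); their signs are all that is used of such a measure. *)
Definition hausdorff (m : nat -> R) : Prop := forall k n, 0 <= diff k m n.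

Lemma diff_ext (k : nat) (u v : nat -> R) (n : nat) :
  (forall i, u i = v i) -> diff k u n = diff k v n.
Proof.
  revert u v; induction k as [|k IH]; intros u v H; simpl; auto.
  apply IH; intro i; rewrite !H; reflexivity.
Qed.

Lemma diff_plus (k : nat) (u v : nat -> R) (n : nat) :
  diff k (fun i => u i + v i) n = diff k u n + diff k v n.
Proof.
  revert u v; induction k as [|k IH]; intros u v; simpl; auto.
  rewrite <- IH; apply diff_ext; intro i; ring.
Qed.

Lemma diff_scal (k : nat) (c : R) (u : nat -> R) (n : nat) :
  diff k (fun i => c * u i) n = c * diff k u n.
Proof.
  revert u; induction k as [|k IH]; intros u; simpl; auto.
  rewrite <- IH; apply diff_ext; intro i; ring.
Qed.

Lemma diff_shift (k : nat) (u : nat -> R) (n : nat) :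
  diff k (fun i => u (S i)) n = diff k u (S n).
Proof.
  revert u; induction k as [|k IH]; intros u; simpl; auto.
  apply (IH (fun i => u i - u (S i))).
Qed.

Lemma diff_pow (k : nat) (t : R) (n : nat) :
  diff k (fun i => t ^ i) n = t ^ n * (1 - t) ^ k.
Proof.
  induction k as [|k IH]; simpl; [ring|].
  rewrite (diff_ext k _ (fun i => (1 - t) * t ^ i)) by (intro i; simpl; ring).
  rewrite (diff_scal k (1 - t) (fun i => t ^ i)), IH; ring.
Qed.

Lemma diff_zero (k n : nat) : diff k (fun _ => 0) n = 0.
Proof.
  rewrite (diff_ext k _ (fun i => 0 * 0)) by (intro; ring).
  rewrite diff_scal; ring.
Qed.

Lemma is_lim_seq_diff (u : nat -> nat -> R) (m : nat -> R) (k n : nat) :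
  (forall i, is_lim_seq (fun K => u K i) (m i)) ->
  is_lim_seq (fun K => diff k (u K) n) (diff k m n).
Proof.
  revert u m; induction k as [|k IH]; intros u m H; simpl; auto.
  apply (IH (fun K i => u K i - u K (S i))); intro i.
  apply is_lim_seq_minus'; apply H.
Qed.

Lemma is_lim_diff (u : nat -> R -> R) (m : nat -> R) (x : Rbar) (k n : nat) :
  (forall i, is_lim (u i) x (m i)) ->
  is_lim (fun s => diff k (fun i => u i s) n) x (diff k m n).
Proof.
  revert u m; induction k as [|k IH]; intros u m H; simpl; auto.
  apply (IH (fun i s => u i s - u (S i) s)); intro i.
  apply is_lim_minus'; apply H.
Qed.

Lemma is_derive_diff (u : nat -> R -> R) (du : nat -> R) (x : R) (k n : nat) :
  (forall i, is_derive (u i) x (du i)) ->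
  is_derive (fun s => diff k (fun i => u i s) n) x (diff k du n).
Proof.
  revert u du; induction k as [|k IH]; intros u du H; simpl; auto.
  apply (IH (fun i s => u i s - u (S i) s)); intro i.
  apply (is_derive_minus (u i) (u (S i))); apply H.
Qed.

Lemma hausdorff_ge0 (m : nat -> R) (n : nat) : hausdorff m -> 0 <= m n.
Proof. intro H; apply (H 0%nat). Qed.

Lemma hausdorff_ext (u v : nat -> R) :
  (forall i, u i = v i) -> hausdorff u -> hausdorff v.
Proof. intros E H k n; rewrite <- (diff_ext k u v n E); apply H. Qed.

Lemma hausdorff_sub (m : nat -> R) :
  hausdorff m -> hausdorff (fun i => m i - m (S i)).
Proof. intros H k; apply (H (S k)). Qed.

Lemma hausdorff_shift (m : nat -> R) :
  hausdorff m -> hausdorff (fun i => m (S i)).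
Proof. intros H k n; rewrite diff_shift; apply H. Qed.

Lemma hausdorff_decr (m : nat -> R) (n : nat) : hausdorff m -> m (S n) <= m n.
Proof. intro H; generalize (H 1%nat n); simpl; lra. Qed.

Lemma hausdorff_le0 (m : nat -> R) (n : nat) : hausdorff m -> m n <= m 0%nat.
Proof.
  intro H; induction n as [|n IH]; [lra|].
  generalize (hausdorff_decr m n H); lra.
Qed.

Lemma hausdorff_plus (u v : nat -> R) :
  hausdorff u -> hausdorff v -> hausdorff (fun i => u i + v i).
Proof.
  intros Hu Hv k n; rewrite diff_plus.
  generalize (Hu k n) (Hv k n); lra.
Qed.

Lemma hausdorff_scal (c : R) (u : nat -> R) :
  0 <= c -> hausdorff u -> hausdorff (fun i => c * u i).
Proof. intros Hc Hu k n; rewrite diff_scal; apply Rmult_le_pos; auto. Qed.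

Lemma hausdorff_const (c : R) : 0 <= c -> hausdorff (fun _ => c).
Proof.
  intros Hc [|k] n; simpl; [exact Hc|].
  rewrite (diff_ext k _ (fun _ => 0)) by (intro; ring).
  rewrite diff_zero; lra.
Qed.

(* With [E] the shift, [uv - E(uv) = (u - Eu) v + Eu (v - Ev)], and each factor
   on the right is again a Hausdorff sequence. *)
Lemma hausdorff_mult (u v : nat -> R) :
  hausdorff u -> hausdorff v -> hausdorff (fun i => u i * v i).
Proof.
  intros Hu Hv k; revert u v Hu Hv; induction k as [|k IH];
    intros u v Hu Hv n; simpl.
  - apply Rmult_le_pos; apply hausdorff_ge0; assumption.
  - rewrite (diff_ext k _ (fun i => (u i - u (S i)) * v i
                                 + u (S i) * (v i - v (S i))))
      by (intro i; ring).
    rewrite diff_plus; apply Rplus_le_le_0_compat.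
    + apply (IH (fun i => u i - u (S i)) v); auto using hausdorff_sub.
    + apply (IH (fun i => u (S i)) (fun i => v i - v (S i)));
        auto using hausdorff_sub, hausdorff_shift.
Qed.

Lemma hausdorff_lim (u : nat -> nat -> R) (m : nat -> R) :
  (forall K, hausdorff (u K)) ->
  (forall i, is_lim_seq (fun K => u K i) (m i)) -> hausdorff m.
Proof.
  intros Hu Hl k n.
  apply (is_lim_seq_le (fun _ => 0) (fun K => diff k (u K) n) 0 (diff k m n)).
  - intro K; apply Hu.
  - apply is_lim_seq_const.
  - apply is_lim_seq_diff, Hl.
Qed.

Lemma hausdorff_pow (u : nat -> R) (j : nat) :
  hausdorff u -> hausdorff (fun i => u i ^ j).
Proof.
  intro Hu; induction j as [|j IH]; simpl.
  - apply hausdorff_const; lra.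
  - apply (hausdorff_mult u (fun i => u i ^ j)); assumption.
Qed.

(** The partial sums of the exponential series are polynomials in [u] with nonnegative coefficients,
    and the Hausdorff property survives products, sums and pointwise limits. *)
Lemma hausdorff_exp (u : nat -> R) :
  hausdorff u -> hausdorff (fun i => exp (u i)).
Proof.
  intro Hu.
  apply (hausdorff_lim (fun K i => sum_n (fun j => / INR (fact j) * u i ^ j) K)).
  - intro K; induction K as [|K IH].
    + apply (hausdorff_ext (fun i => / INR (fact 0) * u i ^ 0)).
      { intro i; rewrite sum_O; reflexivity. }
      apply (hausdorff_scal _ (fun i => u i ^ 0)).
      * apply Rlt_le, Rinv_0_lt_compat, INR_fact_lt_0.
      * apply hausdorff_pow, Hu.
    + apply (hausdorff_ext (fun i => sum_n (fun j => / INR (fact j) * u i ^ j) K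
                                     + / INR (fact (S K)) * u i ^ S K)).
      { intro i; rewrite sum_Sn; reflexivity. }
      apply (hausdorff_plus _ (fun i => / INR (fact (S K)) * u i ^ S K)); [exact IH|].
      apply (hausdorff_scal _ (fun i => u i ^ S K)).
      * apply Rlt_le, Rinv_0_lt_compat, INR_fact_lt_0.
      * apply hausdorff_pow, Hu.
  - intro i.
    generalize (proj1 (is_pseries_R _ _ _) (is_exp_Reals (u i))); intro H; exact H.
Qed.

Lemma exp_le (x y : R) : x <= y -> exp x <= exp y.
Proof.
  intros [H| ->]; [apply Rlt_le, exp_increasing, H|lra].
Qed.

Lemma exp_le_1 (x : R) : x <= 0 -> exp x <= 1.
Proof. rewrite <- exp_0; apply exp_le. Qed.

(** * The sequence (A)_n / (B)_n *)

(** Takes the place of writing [f x] as the improper integral of [- df] over [x, oo). *)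
Lemma nonincreasing_lim0_ge0 (f df : R -> R) (x : R) :
  (forall y, x <= y -> is_derive f y (df y)) ->
  (forall y, x <= y -> df y <= 0) ->
  is_lim f p_infty 0 -> 0 <= f x.
Proof.
  intros Hd Hneg Hl.
  apply (is_lim_le_loc f (fun _ => f x) p_infty 0 (f x)).
  2: exact Hl.
  2: apply is_lim_const.
  - exists x; intros y Hy.
    destruct (MVT_gen f x y df) as [c [Hc E]].
    + intros z Hz; rewrite Rmin_left in Hz by lra; apply Hd; lra.
    + intros z Hz; rewrite Rmin_left in Hz by lra.
      apply continuity_pt_filterlim.
      apply (ex_derive_continuous f); eexists; apply Hd; lra.
    + rewrite Rmin_left, Rmax_right in Hc by lra.
      generalize (Hneg c (proj1 Hc)); nra.
Qed.

Definition lsum {T : Type} (f : T -> R) (l : list T) : R := Rlist_sum (map f l).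

Lemma lsum_cons {T : Type} (f : T -> R) (p : T) (l : list T) :
  lsum f (p :: l) = f p + lsum f l.
Proof. reflexivity. Qed.

Lemma is_derive_lsum {T : Type} (f : T -> R -> R) (df : T -> R) (l : list T) (x : R) :
  (forall p, In p l -> is_derive (f p) x (df p)) ->
  is_derive (fun s => lsum (fun p => f p s) l) x (lsum df l).
Proof.
  induction l as [|p l IH]; intro H.
  - apply (is_derive_const (V := R_NormedModule) 0 x).
  - apply (is_derive_plus (f p) (fun s => lsum (fun p => f p s) l)).
    + apply H; left; reflexivity.
    + apply IH; intros q Hq; apply H; right; exact Hq.
Qed.

Lemma is_lim_lsum0 {T : Type} (f : T -> R -> R) (l : list T) (x : Rbar) :
  (forall p, In p l -> is_lim (f p) x 0) ->
  is_lim (fun s => lsum (fun p => f p s) l) x 0.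
Proof.
  induction l as [|p l IH]; intro H.
  - apply is_lim_const.
  - replace (Finite 0) with (Finite (0 + 0)) by (f_equal; ring).
    apply (is_lim_plus' (f p) (fun s => lsum (fun p => f p s) l)).
    + apply H; left; reflexivity.
    + apply IH; intros q Hq; apply H; right; exact Hq.
Qed.

Lemma lsum_ext {T : Type} (f g : T -> R) (l : list T) :
  (forall p, In p l -> f p = g p) -> lsum f l = lsum g l.
Proof.
  intro H; unfold lsum; f_equal; apply map_ext_in, H.
Qed.

Lemma lsum_scal {T : Type} (c : R) (f : T -> R) (l : list T) :
  lsum (fun p => c * f p) l = c * lsum f l.
Proof.
  induction l as [|p l IH]; [unfold lsum; simpl; ring|].
  rewrite !lsum_cons, IH; ring.
Qed.

Definition vpair (l : list (R * R)) (t : R) : R :=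
  lsum (fun p => Rpower t (fst p) - Rpower t (snd p)) l.

Definition all_pos (l : list (R * R)) : Prop :=
  forall p, In p l -> 0 < fst p /\ 0 < snd p.

Lemma is_lim_exp_decay (c : R) :
  0 < c -> is_lim (fun s => exp (- c * s) / c) p_infty 0.
Proof.
  intro Hc.
  replace (Finite 0) with (Rbar_mult 0 (/ c)) by (simpl; f_equal; ring).
  apply is_lim_scal_r.
  apply (is_lim_comp exp (fun s => - c * s) p_infty 0 m_infty).
  - apply is_lim_exp_m.
  - replace m_infty with (Rbar_mult (- c) p_infty).
    + apply is_lim_scal_l, is_lim_id.
    + simpl. destruct (Rle_dec 0 (- c)) as [H|H]; [exfalso; lra|reflexivity].
  - exists 0; intros; discriminate.
Qed.

(* [sum_j 1/(a_j+y) - 1/(b_j+y)] is the integral of [v(t) t^(y-1)] over [0,1], and taking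
   [k] differences in [y] inserts the factor [(1-t)^k]; with [t = exp(-s)], [W]
   below is the integral over [[0, exp(-s)]], written in closed form. *)
Lemma diff_partial_fractions_ge0 (l : list (R * R)) (y : R) (k : nat) :
  all_pos l -> 0 <= y -> (forall t, 0 < t <= 1 -> 0 <= vpair l t) ->
  0 <= diff k (fun n => lsum (fun p => / (fst p + y + INR n) - / (snd p + y + INR n)) l) 0.
Proof.
  intros Hl Hy Hv.
  set (u := fun n s => lsum (fun p => exp (- (fst p + y + INR n) * s) / (fst p + y + INR n)
                                  - exp (- (snd p + y + INR n) * s) / (snd p + y + INR n)) l).
  set (W := fun s => diff k (fun n => u n s) 0).
  set (du := fun s n => lsum (fun p => - exp (- (fst p + y + INR n) * s)
                                   + exp (- (snd p + y + INR n) * s)) l).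
  assert (Hpos : forall p n, In p l -> 0 < fst p + y + INR n /\ 0 < snd p + y + INR n).
  { intros p n Hp; destruct (Hl p Hp); generalize (pos_INR n); lra. }
  assert (HW : 0 <= W 0).
  { apply (nonincreasing_lim0_ge0 W (fun s => diff k (du s) 0)).
    - intros s _; apply is_derive_diff; intro n.
      unfold u, du.
      apply (is_derive_lsum (fun p s => exp (- (fst p + y + INR n) * s) / (fst p + y + INR n)
                                  - exp (- (snd p + y + INR n) * s) / (snd p + y + INR n))).
      intros p Hp; destruct (Hpos p n Hp).
      auto_derive; [lra|field; lra].
    - intros s Hs.
      (* The derivative depends on [n] only through the geometric sequence [exp (- s) ^ n], whose
         [k]-th difference is [(1 - exp (- s)) ^ k] at index 0; the remaining factor is [- v(t) t^y]
         at [t = exp (- s)]. *)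
      rewrite (diff_ext k _ (fun n => - (exp (- y * s) * vpair l (exp (- s))) * exp (- s) ^ n)).
      + rewrite (diff_scal k _ (fun n => exp (- s) ^ n)), diff_pow.
        assert (0 <= vpair l (exp (- s))).
        { apply Hv; split; [apply exp_pos|apply exp_le_1; lra]. }
        assert (0 <= 1 - exp (- s)) by (generalize (exp_le_1 (- s)); lra).
        assert (0 <= (1 - exp (- s)) ^ k) by (apply pow_le; assumption).
        assert (0 < exp (- y * s)) by apply exp_pos.
        simpl.
        assert (0 <= exp (- y * s) * vpair l (exp (- s))) by (apply Rmult_le_pos; lra).
        assert (0 <= exp (- y * s) * vpair l (exp (- s)) * (1 - exp (- s)) ^ k)
          by (apply Rmult_le_pos; lra).
        lra.
      + intro n; unfold du, vpair.
        rewrite (lsum_ext _ (fun p => (- (exp (- y * s) * exp (- s) ^ n)) *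
                          (Rpower (exp (- s)) (fst p) - Rpower (exp (- s)) (snd p)))).
        * rewrite lsum_scal; ring.
        * intros p _; unfold Rpower; rewrite !ln_exp.
          assert (E : exp (- s) ^ n = exp (- INR n * s)).
          { induction n as [|n IH]; [simpl; rewrite <- exp_0; f_equal; ring|].
            rewrite S_INR; simpl pow; rewrite IH, <- exp_plus; f_equal; ring. }
          rewrite E.
          replace (- (fst p + y + INR n) * s) with
            (- y * s + (- INR n * s + fst p * - s)) by ring.
          replace (- (snd p + y + INR n) * s) with
            (- y * s + (- INR n * s + snd p * - s)) by ring.
          rewrite !exp_plus; ring.
    - unfold W. rewrite <- (diff_zero k 0).
      apply is_lim_diff; intro n; unfold u.
      apply (is_lim_lsum0 (fun p s => exp (- (fst p + y + INR n) * s) / (fst p + y + INR n)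
                                  - exp (- (snd p + y + INR n) * s) / (snd p + y + INR n))).
      intros p Hp; destruct (Hpos p n Hp).
      replace (Finite 0) with (Finite (0 - 0)) by (f_equal; ring).
      apply is_lim_minus'; apply is_lim_exp_decay; assumption. }
  replace (diff k _ 0) with (W 0); [exact HW|].
  apply diff_ext; intro n; unfold u; apply lsum_ext; intros p Hp.
  rewrite !Rmult_0_r, exp_0; unfold Rdiv; ring.
Qed.

Definition log_ratio (l : list (R * R)) (x : R) : R :=
  lsum (fun p => ln (snd p + x) - ln (fst p + x)) l.

Lemma is_lim_log_ratio (l : list (R * R)) :
  is_lim (log_ratio l) p_infty 0.
Proof.
  apply (is_lim_lsum0 (fun p x => ln (snd p + x) - ln (fst p + x))).
  intros [a b] _; simpl.
  apply (is_lim_ext_loc (fun x => ln (1 + (b - a) * / (a + x)))).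
  - exists (Rmax 1 (Rmax (1 - a) (1 - b))); intros x Hx.
    assert (1 < x /\ 1 - a < x /\ 1 - b < x) as (H1 & H2 & H3).
    { generalize (Rmax_l 1 (Rmax (1 - a) (1 - b)))
                 (Rmax_r 1 (Rmax (1 - a) (1 - b)))
                 (Rmax_l (1 - a) (1 - b)) (Rmax_r (1 - a) (1 - b)); lra. }
    rewrite <- ln_div by lra.
    f_equal; field; lra.
  - rewrite <- ln_1.
    apply (is_lim_comp_continuous (fun x => 1 + (b - a) * / (a + x)) ln p_infty 1).
    + replace (Finite 1) with (Finite (1 + 0)) by (f_equal; ring).
      apply is_lim_plus'; [apply is_lim_const|].
      replace (Finite 0) with (Rbar_mult (b - a) 0) by (simpl; f_equal; ring).
      apply is_lim_scal_l.
      replace (Finite 0) with (Rbar_inv p_infty) by reflexivity.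
      apply is_lim_inv; [|discriminate].
      eapply is_lim_plus; [apply is_lim_const|apply is_lim_id|reflexivity].
    + apply continuity_pt_filterlim, derivable_continuous_pt.
      exists (/ 1); apply derivable_pt_lim_ln; lra.
Qed.

(** A difference of [log_ratio], as a function of a real base point [x], tends to 0 at infinity and
    has minus a difference of the partial fractions as derivative, so it decreases to 0. *)
Lemma hausdorff_log_ratio (l : list (R * R)) :
  all_pos l -> (forall t, 0 < t <= 1 -> 0 <= vpair l t) ->
  hausdorff (fun n => log_ratio l (INR n)).
Proof.
  intros Hl Hv k n.
  (* Moves the index [n] into the argument of [log_ratio], where it can be replaced by a real
     variable and differentiated. *)
  assert (E : forall i, diff k (fun n => log_ratio l (INR n)) i
                        = diff k (fun j => log_ratio l (INR i + INR j)) 0).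
  { clear. intro i. revert k.
    enough (H : forall k u v, (forall j, u (i + j)%nat = v j) -> diff k u (i + 0)%nat = diff k v 0).
    { intro k; rewrite <- (Nat.add_0_r i) at 1; apply H.
      intro j; rewrite plus_INR; reflexivity. }
    induction k as [|k IH]; intros u v H; simpl; auto.
    apply IH; intro j; rewrite <- H, <- H, Nat.add_succ_r; reflexivity. }
  rewrite E.
  apply (nonincreasing_lim0_ge0 (fun x => diff k (fun j => log_ratio l (x + INR j)) 0)
    (fun x => - diff k (fun j => lsum (fun p => / (fst p + x + INR j) - / (snd p + x + INR j)) l) 0)).
  - intros x Hx.
    assert (0 <= x) by (generalize (pos_INR n); lra).
    rewrite <- (Rmult_1_l (diff k _ 0)), Ropp_mult_distr_l, <- diff_scal.
    apply is_derive_diff; intro j.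
    unfold log_ratio; rewrite <- lsum_scal.
    apply (is_derive_lsum (fun p x => ln (snd p + (x + INR j)) - ln (fst p + (x + INR j)))).
    intros p Hp; destruct (Hl p Hp); generalize (pos_INR j); intro.
    auto_derive; [split; lra|field; split; lra].
  - intros x Hx.
    generalize (diff_partial_fractions_ge0 l x k Hl); intro P.
    assert (0 <= x) by (generalize (pos_INR n); lra).
    specialize (P H Hv); lra.
  - rewrite <- (diff_zero k 0).
    apply is_lim_diff; intro j.
    apply (is_lim_comp (log_ratio l) (fun x => x + INR j) p_infty 0 p_infty).
    + apply is_lim_log_ratio.
    + eapply is_lim_plus; [apply is_lim_id|apply is_lim_const|reflexivity].
    + exists 0; intros; discriminate.
Qed.

Definition poch_ratio (l : list (R * R)) (n : nat) : R :=
  Rlist_prod (map (fun p => poch (fst p) n / poch (snd p) n) l).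

Lemma poch_pos (a : R) (n : nat) : 0 < a -> 0 < poch a n.
Proof.
  intro Ha; induction n as [|n IH]; simpl; [lra|].
  apply Rmult_lt_0_compat; [exact IH|generalize (pos_INR n); lra].
Qed.

Lemma poch_ratio_pos (l : list (R * R)) (n : nat) :
  all_pos l -> 0 < poch_ratio l n.
Proof.
  intro Hl; unfold poch_ratio; induction l as [|p l IH]; simpl; [lra|].
  destruct (Hl p (or_introl eq_refl)).
  apply Rmult_lt_0_compat.
  - apply Rdiv_lt_0_compat; apply poch_pos; assumption.
  - apply IH; intros q Hq; apply Hl; right; exact Hq.
Qed.

Lemma poch_ratio_succ (l : list (R * R)) (n : nat) :
  all_pos l ->
  poch_ratio l (S n) * exp (log_ratio l (INR n)) = poch_ratio l n.
Proof.
  unfold poch_ratio, log_ratio; intro Hl; induction l as [|p l IH].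
  - simpl; unfold lsum; simpl; rewrite exp_0; ring.
  - rewrite lsum_cons; simpl map; simpl Rlist_prod.
    rewrite <- IH by (intros q Hq; apply Hl; right; exact Hq).
    destruct (Hl p (or_introl eq_refl)).
    generalize (pos_INR n); intro.
    rewrite exp_plus, <- ln_div, exp_ln by (try apply Rdiv_lt_0_compat; lra).
    simpl poch; field.
    generalize (poch_pos (snd p) n); intro.
    repeat split; lra.
Qed.

(* [m_n = lim_K m_K (m_n / m_(n+K))], and [m_n / m_(n+K)] is a product of shifts
   of [exp (log_ratio l n) = m_n / m_(n+1)]. *)
Lemma hausdorff_poch_ratio_pos (l : list (R * R)) :
  all_pos l -> (forall t, 0 < t <= 1 -> 0 <= vpair l t) ->
  hausdorff (poch_ratio l).
Proof.
  intros Hl Hv.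
  set (m := poch_ratio l).
  assert (Hm : forall n, 0 < m n) by (intro; apply poch_ratio_pos, Hl).
  assert (Hs : forall n, m n / m (S n) = exp (log_ratio l (INR n))).
  { intro n; unfold m at 1; rewrite <- (poch_ratio_succ l n Hl); fold m.
    field; generalize (Hm (S n)); lra. }
  assert (Hh : hausdorff (fun n => exp (log_ratio l (INR n)))).
  { apply hausdorff_exp, hausdorff_log_ratio; assumption. }
  apply (hausdorff_lim (fun K n => m K * (m n / m (n + K)%nat))).
  - intro K; apply (hausdorff_scal (m K)); [apply Rlt_le, Hm|].
    induction K as [|K IH].
    + apply (hausdorff_ext (fun _ => 1)); [|apply hausdorff_const; lra].
      intro n; rewrite Nat.add_0_r; field; generalize (Hm n); lra.
    + apply (hausdorff_ext (fun n => (m n / m (n + K)%nat)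
                                     * exp (log_ratio l (INR (n + K))))).
      * intro n; rewrite <- Hs, Nat.add_succ_r; field.
        generalize (Hm (n + K)%nat) (Hm (S (n + K))); lra.
      * apply hausdorff_mult; [exact IH|].
        (* The new factor is the [K]-fold shift of [exp (log_ratio l n)]. *)
        clear IH; induction K as [|K IH].
        -- eapply hausdorff_ext; [|exact Hh]; intro n; simpl.
           rewrite Nat.add_0_r; reflexivity.
        -- eapply hausdorff_ext; [|apply hausdorff_shift, IH]; intro n; simpl.
           rewrite Nat.add_succ_r; reflexivity.
  - intro n.
    apply (is_lim_seq_ext (fun K => m n * (m K / m (K + n)%nat))).
    { intro K; rewrite (Nat.add_comm K n); field; generalize (Hm (n + K)%nat); lra. }
    replace (Finite (m n)) with (Rbar_mult (m n) 1) by (simpl; f_equal; ring).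
    apply is_lim_seq_scal_l.
    (* [m K / m (K + n)] tends to 1: each step in [n] contributes a factor
       [exp (log_ratio l (K + n))], whose exponent tends to 0. *)
    induction n as [|n IH].
    + apply (is_lim_seq_ext (fun _ => 1)); [|apply is_lim_seq_const].
      intro K; rewrite Nat.add_0_r; field; generalize (Hm K); lra.
    + apply (is_lim_seq_ext (fun K => (m K / m (K + n)%nat)
                                      * exp (log_ratio l (INR (K + n))))).
      * intro K; rewrite <- Hs, Nat.add_succ_r; field.
        generalize (Hm (K + n)%nat) (Hm (S (K + n))); lra.
      * replace (Finite 1) with (Finite (1 * exp 0)) by (rewrite exp_0; f_equal; ring).
        apply is_lim_seq_mult'; [exact IH|].
        apply (is_lim_seq_continuous exp).
        -- apply derivable_continuous_pt, derivable_pt_exp.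
        -- apply (is_lim_comp_seq (log_ratio l) _ p_infty).
           ++ apply is_lim_log_ratio.
           ++ exists 0%nat; intros; discriminate.
           ++ apply (is_lim_seq_incr_n INR n), is_lim_seq_INR.
Qed.

(** An upper parameter 0 is treated separately because the logarithm of [a_j + n] breaks down at
    [n = 0]. *)
Lemma hausdorff_poch_ratio (l : list (R * R)) :
  (forall p, In p l -> 0 <= fst p /\ 0 < snd p) ->
  (forall t, 0 < t <= 1 -> 0 <= vpair l t) ->
  hausdorff (poch_ratio l).
Proof.
  intros Hl Hv.
  destruct (in_dec Req_dec_T 0 (map fst l)) as [H0|H0].
  - assert (E : forall n, poch_ratio l (S n) = 0).
    { intro n; clear Hl Hv; unfold poch_ratio; induction l as [|p l IH];
        simpl in *; [contradiction|].
      destruct H0 as [H0|H0]; [|rewrite IH by exact H0; ring].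
      replace (poch (fst p) n * (fst p + INR n)) with 0.
      + unfold Rdiv; ring.
      + rewrite H0; clear; induction n as [|n IH]; simpl in *; [ring|].
        rewrite <- IH; ring. }
    assert (E0 : poch_ratio l 0 = 1).
    { clear; unfold poch_ratio; induction l as [|p l IH]; simpl in *; [reflexivity|].
      rewrite IH; field. }
    (* The indicator of 0 equals its own first difference, so all its differences are
       nonnegative. *)
    assert (H : forall k u, (forall n, u (S n) = 0) -> u 0%nat = 1 ->
                forall n, 0 <= diff k u n).
    { induction k as [|k IH]; intros u U1 U0 n; simpl.
      - destruct n; rewrite ?U0, ?U1; lra.
      - apply IH; [intro; rewrite !U1; ring|rewrite U0, U1; ring]. }
    intro k; apply H; assumption.
  - apply hausdorff_poch_ratio_pos; [|exact Hv].
    intros p Hp; destruct (Hl p Hp) as [[Ha|Ha] Hb]; split; auto.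
    exfalso; apply H0; rewrite Ha; apply in_map, Hp.
Qed.

(** * The moment functional on [0,1] *)

(* [bern N m psi] is the [N]-th Bernstein sum
   [sum_k binomial(N,k) (diff (N-k) m k) psi(k)], i.e. the expectation of [psi] at a
   binomial(N,t) variable, averaged over the representing measure of [m]; the recursion
   conditions on the first trial, failure having weight [1-t] and success weight [t]. *)
Fixpoint bern (N : nat) (m psi : nat -> R) : R :=
  match N with
  | O => m 0%nat * psi 0%nat
  | S P => bern P (fun i => m i - m (S i)) psi
           + bern P (fun i => m (S i)) (fun k => psi (S k))
  end.

Lemma bern_ext (N : nat) (m psi chi : nat -> R) :
  (forall k, (k <= N)%nat -> psi k = chi k) -> bern N m psi = bern N m chi.
Proof.
  revert m psi chi; induction N as [|N IH]; intros m psi chi H; simpl.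
  - rewrite H by lia; reflexivity.
  - f_equal; apply IH; intros k Hk; apply H; lia.
Qed.

Lemma bern_ext_m (N : nat) (u v psi : nat -> R) :
  (forall i, u i = v i) -> bern N u psi = bern N v psi.
Proof.
  revert u v psi; induction N as [|N IH]; intros u v psi H; simpl.
  - rewrite H; reflexivity.
  - f_equal; apply IH; intro i; rewrite !H; reflexivity.
Qed.

Lemma bern_plus (N : nat) (m psi chi : nat -> R) :
  bern N m (fun k => psi k + chi k) = bern N m psi + bern N m chi.
Proof.
  revert m psi chi; induction N as [|N IH]; intros m psi chi; simpl; [ring|].
  rewrite IH, (IH _ (fun k => psi (S k))); ring.
Qed.

Lemma bern_scal (N : nat) (m psi : nat -> R) (c : R) :
  bern N m (fun k => c * psi k) = c * bern N m psi.
Proof.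
  revert m psi; induction N as [|N IH]; intros m psi; simpl; [ring|].
  rewrite IH, (IH _ (fun k => psi (S k))); ring.
Qed.

Lemma bern_plus_m (N : nat) (u v psi : nat -> R) :
  bern N (fun i => u i + v i) psi = bern N u psi + bern N v psi.
Proof.
  revert u v psi; induction N as [|N IH]; intros u v psi; simpl; [ring|].
  rewrite (bern_ext_m N _ (fun i => (u i - u (S i)) + (v i - v (S i))))
    by (intro; ring).
  rewrite IH, (IH (fun i => u (S i)) (fun i => v (S i))); ring.
Qed.

Lemma bern_split (N : nat) (m psi : nat -> R) :
  bern N m psi = bern N (fun i => m i - m (S i)) psi + bern N (fun i => m (S i)) psi.
Proof.
  rewrite <- bern_plus_m; apply bern_ext_m; intro; ring.
Qed.

Lemma bern_const (N : nat) (m : nat -> R) (c : R) :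
  bern N m (fun _ => c) = c * m 0%nat.
Proof.
  revert m; induction N as [|N IH]; intros m; simpl; [ring|].
  rewrite !IH; ring.
Qed.

Lemma bern_ge0 (N : nat) (m psi : nat -> R) :
  hausdorff m -> (forall k, (k <= N)%nat -> 0 <= psi k) -> 0 <= bern N m psi.
Proof.
  revert m psi; induction N as [|N IH]; intros m psi Hm H; simpl.
  - apply Rmult_le_pos; [apply hausdorff_ge0, Hm|apply H; lia].
  - apply Rplus_le_le_0_compat; apply IH.
    + apply hausdorff_sub, Hm.
    + intros k Hk; apply H; lia.
    + apply hausdorff_shift, Hm.
    + intros k Hk; apply H; lia.
Qed.

Lemma bern_le (N : nat) (m psi chi : nat -> R) :
  hausdorff m -> (forall k, (k <= N)%nat -> psi k <= chi k) ->
  bern N m psi <= bern N m chi.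
Proof.
  intros Hm H.
  assert (0 <= bern N m (fun k => chi k + -1 * psi k)).
  { apply bern_ge0; [exact Hm|]; intros k Hk; specialize (H k Hk); lra. }
  rewrite bern_plus, bern_scal in H0; lra.
Qed.

Lemma bern_abs_le (N : nat) (m psi chi : nat -> R) (e : R) :
  hausdorff m -> (forall k, (k <= N)%nat -> Rabs (psi k - chi k) <= e) ->
  Rabs (bern N m psi - bern N m chi) <= e * m 0%nat.
Proof.
  intros Hm H.
  assert (E : forall p q, (forall k, (k <= N)%nat -> Rabs (p k - q k) <= e) ->
     bern N m p <= bern N m q + e * m 0%nat).
  { intros p q Hpq.
    rewrite <- (bern_const N m e), <- bern_plus.
    apply bern_le; [exact Hm|]; intros k Hk.
    generalize (Rle_abs (p k - q k)) (Hpq k Hk); lra. }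
  apply Rabs_le; split.
  - assert (bern N m chi <= bern N m psi + e * m 0%nat); [|lra].
    apply E; intros k Hk; rewrite Rabs_minus_sym; auto.
  - assert (bern N m psi <= bern N m chi + e * m 0%nat); [|lra].
    apply E; auto.
Qed.

(** This is [k C(N+1,k) = (N+1) C(N,k-1)]: weighting by the number of successes amounts to
    prescribing one success and counting the other [N] trials. *)
Lemma bern_succ_success (N : nat) (m psi : nat -> R) :
  bern (S N) m (fun k => INR k * psi k)
  = INR (S N) * bern N (fun i => m (S i)) (fun k => psi (S k)).
Proof.
  revert m psi; induction N as [|N IH]; intros m psi.
  - simpl; ring.
  - change (bern (S (S N)) m (fun k => INR k * psi k)) with
      (bern (S N) (fun i => m i - m (S i)) (fun k => INR k * psi k)
       + bern (S N) (fun i => m (S i)) (fun k => INR (S k) * psi (S k))).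
    rewrite IH.
    rewrite (bern_ext (S N) _ (fun k => INR (S k) * psi (S k))
      (fun k => INR k * psi (S k) + psi (S k)))
      by (intros k _; rewrite S_INR; ring).
    rewrite bern_plus, (IH _ (fun k => psi (S k))).
    rewrite (S_INR (S N)).
    change (bern (S N) (fun i => m (S i)) (fun k => psi (S k))) with
      (bern N (fun i => m (S i) - m (S (S i))) (fun k => psi (S k))
       + bern N (fun i => m (S (S i))) (fun k => psi (S (S k)))).
    ring.
Qed.

(** The counterpart for failures, [(N+1-k) C(N+1,k) = (N+1) C(N,k)]. *)
Lemma bern_succ_failure (N : nat) (m psi : nat -> R) :
  bern (S N) m (fun k => (INR (S N) - INR k) * psi k)
  = INR (S N) * bern N (fun i => m i - m (S i)) psi.
Proof.
  revert m psi; induction N as [|N IH]; intros m psi.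
  - simpl; ring.
  - change (bern (S (S N)) m (fun k => (INR (S (S N)) - INR k) * psi k)) with
      (bern (S N) (fun i => m i - m (S i)) (fun k => (INR (S (S N)) - INR k) * psi k)
       + bern (S N) (fun i => m (S i)) (fun k => (INR (S (S N)) - INR (S k)) * psi (S k))).
    rewrite (bern_ext (S N) _ (fun k => (INR (S (S N)) - INR (S k)) * psi (S k))
      (fun k => (INR (S N) - INR k) * psi (S k)))
      by (intros k _; rewrite (S_INR (S N)), (S_INR k); ring).
    rewrite (bern_ext (S N) _ (fun k => (INR (S (S N)) - INR k) * psi k)
      (fun k => (INR (S N) - INR k) * psi k + psi k))
      by (intros k _; rewrite (S_INR (S N)); ring).
    rewrite bern_plus, IH, (IH _ (fun k => psi (S k))).
    rewrite (S_INR (S N)).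
    change (bern (S N) (fun i => m i - m (S i)) psi) with
      (bern N (fun i => (m i - m (S i)) - (m (S i) - m (S (S i)))) psi
       + bern N (fun i => m (S i) - m (S (S i))) (fun k => psi (S k))).
    ring.
Qed.

(** Among [N+1] trials with [k] successes, a randomly deleted trial is a success with probability
    [k/(N+1)]. At [k = 0] the value [psi (pred 0)] has weight 0. *)
Lemma bern_elevate (N : nat) (m psi : nat -> R) :
  bern N m psi =
  bern (S N) m (fun k => (1 - INR k / INR (S N)) * psi k
                         + INR k / INR (S N) * psi (pred k)).
Proof.
  assert (HN : INR (S N) <> 0) by (apply not_0_INR; lia).
  rewrite (bern_ext (S N) m _
    (fun k => / INR (S N) * ((INR (S N) - INR k) * psi k)
              + / INR (S N) * (INR k * psi (pred k))))
    by (intros k _; field; exact HN).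
  rewrite bern_plus, !bern_scal, bern_succ_success, bern_succ_failure, bern_split.
  change (fun k => psi (pred (S k))) with psi; field; exact HN.
Qed.

(** The remainder bound is exactly what degree elevation consumes, and it is stable under sums and
    products. [dphi] is merely a slope for which the bound holds, so no differentiability at the end
    points has to be discussed. *)
Definition tame_with (phi dphi : R -> R) (M : R) : Prop :=
  0 <= M /\ forall x, 0 <= x <= 1 ->
    Rabs (phi x) <= M /\ Rabs (dphi x) <= M /\
    forall y, 0 <= y <= 1 -> Rabs (phi y - phi x - dphi x * (y - x)) <= M * (y - x) ^ 2.

Definition tame (phi : R -> R) : Prop := exists dphi M, tame_with phi dphi M.

(** The degree is [S N], so that the grid [k / S N] never divides by 0. *)
Definition bernstein_mean (m : nat -> R) (phi : R -> R) (N : nat) : R :=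
  bern (S N) m (fun k => phi (INR k / INR (S N))).

(* Degree elevation replaces [phi(l/N)] by a two-point mean with the same barycenter,
   at distance at most [1/N], so only the quadratic error of [phi] enters. *)
Lemma bernstein_mean_step (m : nat -> R) (phi dphi : R -> R) (M : R) (N : nat) :
  hausdorff m -> tame_with phi dphi M ->
  Rabs (bernstein_mean m phi (S N) - bernstein_mean m phi N)
  <= M * (/ INR (S N)) ^ 2 * m 0%nat.
Proof.
  intros Hm [HM H]; unfold bernstein_mean.
  rewrite (bern_elevate (S N)).
  apply bern_abs_le; [exact Hm|]; intros k Hk.
  rewrite Rabs_minus_sym.
  set (n := S N); set (p := INR k / INR (S n)).
  assert (Hn : 0 < INR n) by (apply lt_0_INR; unfold n; lia).
  assert (HSn : INR (S n) = INR n + 1) by apply S_INR.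
  assert (Hk1 : INR k <= INR n + 1) by (rewrite <- HSn; apply le_INR; exact Hk).
  assert (Hk0 : 0 <= INR k) by apply pos_INR.
  assert (Hp : 0 <= p <= 1).
  { unfold p; rewrite HSn; split.
    - apply Rdiv_le_0_compat; lra.
    - apply (Rdiv_le_1 (INR k)); lra. }
  set (T := fun y => phi y - phi p - dphi p * (y - p)).
  (* The alternative [w = 0] serves [k = S n]: there [y1 = (n+1)/n] lies outside [0,1], but its
     weight [1 - p] vanishes. *)
  assert (HT : forall w y, 0 <= w -> Rabs (y - p) <= / INR n ->
             (w = 0 \/ 0 <= y <= 1) -> Rabs (w * T y) <= w * (M * (/ INR n) ^ 2)).
  { intros w y Hw Hd Hy; rewrite Rabs_mult, (Rabs_pos_eq w) by exact Hw.
    destruct Hy as [-> |Hy]; [lra|].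
    apply Rmult_le_compat_l; [exact Hw|].
    eapply Rle_trans; [apply (proj2 (proj2 (H p Hp)) y Hy)|].
    apply Rmult_le_compat_l; [exact HM|].
    rewrite <- (pow2_abs (y - p)); apply pow_incr; split; [apply Rabs_pos|exact Hd]. }
  set (y1 := INR k / INR n); set (y2 := INR (pred k) / INR n).
  assert (Hpred : k = 0%nat \/ INR (pred k) = INR k - 1).
  { destruct k; [left; reflexivity|right; rewrite S_INR; simpl; ring]. }
  (* The barycenter of [y1] and [y2] is [p], so the linear Taylor terms cancel. *)
  assert (B1 : (1 - p) * (y1 - p) + p * (y2 - p) = 0).
  { unfold y2; destruct Hpred as [Hz|Hz].
    - unfold y1, p; rewrite Hz; simpl; unfold Rdiv; ring.
    - rewrite Hz; unfold y1, p; rewrite HSn; field; lra. }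
  replace ((1 - p) * phi y1 + p * phi y2 - phi p) with
    ((1 - p) * T y1 + p * T y2)
    by (unfold T; transitivity ((1 - p) * phi y1 + p * phi y2 - phi p
           - dphi p * ((1 - p) * (y1 - p) + p * (y2 - p))); [ring|rewrite B1; ring]).
  eapply Rle_trans; [apply Rabs_triang|].
  replace (M * (/ INR n) ^ 2) with
    ((1 - p) * (M * (/ INR n) ^ 2) + p * (M * (/ INR n) ^ 2)) by ring.
  apply Rplus_le_compat; apply HT.
  - lra.
  (* The two points lie at distances [p/n] and [(1-p)/n] from [p], both at most [1/n]. *)
  - assert (E : y1 - p = p * / INR n) by (unfold y1, p; rewrite HSn; field; lra).
    rewrite E, Rabs_pos_eq.
    + assert (0 < / INR n) by (apply Rinv_0_lt_compat, Hn); nra.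
    + apply Rmult_le_pos; [lra|apply Rlt_le, Rinv_0_lt_compat, Hn].
  - destruct (Nat.eq_dec k (S n)) as [->|Hne].
    + left; unfold p; field; lra.
    + right; unfold y1.
      assert (INR k <= INR n) by (apply le_INR; lia).
      split; [apply Rdiv_le_0_compat; lra|apply (Rdiv_le_1 (INR k)); lra].
  - lra.
  - assert (0 < / INR n) by (apply Rinv_0_lt_compat, Hn).
    destruct Hpred as [Hz|Hz].
    + unfold y2, p; rewrite Hz; change (INR (pred 0)) with 0; change (INR 0) with 0; unfold Rdiv; rewrite !Rmult_0_l, Rminus_0_r, Rabs_R0; lra.
    + assert (E : y2 - p = - ((1 - p) * / INR n)).
      { unfold y2, p; rewrite Hz, HSn; field; lra. }
      rewrite E, Rabs_Ropp, Rabs_pos_eq by (apply Rmult_le_pos; lra); nra.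
  - right; unfold y2.
    assert (INR (pred k) <= INR n) by (apply le_INR; lia).
    split; [apply Rdiv_le_0_compat; [apply pos_INR|lra]|apply (Rdiv_le_1 (INR (pred k))); lra].
Qed.

(** For [x >= 1] one has [1/x^2 <= 2 (1/x - 1/(x+1))], so the increments are dominated by a
    telescoping sum with tail at most [2K/(n+1)]. *)
Lemma cauchy_inv_square (a : nat -> R) (K : R) :
  (forall n, Rabs (a (S n) - a n) <= K * (/ INR (S n)) ^ 2) -> ex_finite_lim_seq a.
Proof.
  intro H.
  assert (HK : 0 <= K).
  { generalize (H 0%nat) (Rabs_pos (a 1%nat - a 0%nat)); simpl; lra. }
  assert (T : forall n p, Rabs (a (p + n)%nat - a n) <= 2 * K * (/ INR (S n) - / INR (S (p + n)))).
  { intros n p; induction p as [|p IH].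
    - change (0 + n)%nat with n; rewrite !Rminus_diag, Rabs_R0; lra.
    - replace (a (S p + n)%nat - a n) with
        ((a (S (p + n)) - a (p + n)%nat) + (a (p + n)%nat - a n)) by (simpl; ring).
      eapply Rle_trans; [apply Rabs_triang|].
      assert (K * (/ INR (S (p + n))) ^ 2 <=
              2 * K * (/ INR (S (p + n)) - / INR (S (S p + n)))).
      { change (S p + n)%nat with (S (p + n)); rewrite (S_INR (S (p + n))).
        assert (1 <= INR (S (p + n))) by (rewrite S_INR; generalize (pos_INR (p + n)); lra).
        set (x := INR (S (p + n))) in *.
        replace (2 * K * (/ x - / (x + 1))) with (K * (/ x) ^ 2 * (2 * x / (x + 1)))
          by (field; lra).
        rewrite <- (Rmult_1_r (K * (/ x) ^ 2)) at 1.
        apply Rmult_le_compat_l.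
        - apply Rmult_le_pos; [exact HK|apply pow2_ge_0].
        - apply (Rle_div_r 1); lra. }
      specialize (H (p + n)%nat); lra. }
  apply ex_lim_seq_cauchy_corr; intro eps.
  assert (HI : is_lim_seq (fun n => 2 * K * / INR (S n)) 0).
  { replace (Finite 0) with (Rbar_mult (2 * K) 0) by (simpl; f_equal; ring).
    apply is_lim_seq_scal_l.
    replace (Finite 0) with (Rbar_inv p_infty) by reflexivity.
    apply is_lim_seq_inv; [|discriminate].
    apply (is_lim_seq_incr_1 INR), is_lim_seq_INR. }
  destruct (proj2 (is_lim_seq_spec _ _) HI eps) as [N0 HN0].
  exists N0.
  assert (T2 : forall n p, (N0 <= n)%nat -> Rabs (a (p + n)%nat - a n) < eps).
  { intros n p Hn; specialize (HN0 n Hn); simpl in HN0.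
    rewrite Rminus_0_r in HN0.
    eapply Rle_lt_trans; [apply T|].
    eapply Rle_lt_trans; [|exact HN0].
    eapply Rle_trans; [|apply Rle_abs].
    apply Rmult_le_compat_l; [lra|].
    assert (0 < / INR (S (p + n))) by (apply Rinv_0_lt_compat, lt_0_INR; lia).
    change (/ INR (S n) - / INR (S (p + n)) <= / INR (S n)); lra. }
  intros n p Hn Hp.
  destruct (Nat.le_ge_cases n p) as [Hnp|Hnp].
  - rewrite Rabs_minus_sym.
    replace p with ((p - n) + n)%nat by lia; apply T2, Hn.
  - replace n with ((n - p) + p)%nat by lia; apply T2, Hp.
Qed.

Definition moment (m : nat -> R) (phi : R -> R) : R :=
  real (Lim_seq (bernstein_mean m phi)).

(** The relational form lets limits be added and scaled directly, without first proving the combined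
    function [tame]. *)
Definition is_moment (m : nat -> R) (phi : R -> R) (l : R) : Prop :=
  is_lim_seq (bernstein_mean m phi) l.

Lemma moment_correct (m : nat -> R) (phi : R -> R) :
  hausdorff m -> tame phi -> is_moment m phi (moment m phi).
Proof.
  intros Hm [dphi [M H]].
  apply Lim_seq_correct'.
  apply (cauchy_inv_square _ (M * m 0%nat)); intro n.
  eapply Rle_trans; [apply (bernstein_mean_step m phi dphi M); assumption|].
  right; ring.
Qed.

Lemma is_moment_unique (m : nat -> R) (phi : R -> R) (l : R) :
  is_moment m phi l -> moment m phi = l.
Proof. intro H; unfold moment; rewrite (is_lim_seq_unique _ _ H); reflexivity. Qed.

Lemma grid_in_unit (N k : nat) : (k <= S N)%nat -> 0 <= INR k / INR (S N) <= 1.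
Proof.
  intro Hk; assert (0 < INR (S N)) by (apply lt_0_INR; lia).
  split; [apply Rdiv_le_0_compat; [apply pos_INR|lra]|].
  apply (Rdiv_le_1 (INR k)); [lra|apply le_INR, Hk].
Qed.

Lemma is_moment_ext (m : nat -> R) (phi psi : R -> R) (l : R) :
  (forall t, 0 <= t <= 1 -> phi t = psi t) -> is_moment m phi l -> is_moment m psi l.
Proof.
  intros H; apply is_lim_seq_ext; intro N.
  apply bern_ext; intros k Hk; apply H, grid_in_unit, Hk.
Qed.

Lemma is_moment_plus (m : nat -> R) (phi psi : R -> R) (l l' : R) :
  is_moment m phi l -> is_moment m psi l' -> is_moment m (fun t => phi t + psi t) (l + l').
Proof.
  intros H H'; eapply is_lim_seq_ext; [|apply (is_lim_seq_plus' _ _ _ _ H H')].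
  intro N; symmetry; apply (bern_plus (S N)).
Qed.

Lemma is_moment_scal (m : nat -> R) (phi : R -> R) (c l : R) :
  is_moment m phi l -> is_moment m (fun t => c * phi t) (c * l).
Proof.
  intros H; eapply is_lim_seq_ext; [|apply (is_lim_seq_scal_l _ c _ H)].
  intro N; symmetry; apply (bern_scal (S N)).
Qed.

Lemma is_moment_const (m : nat -> R) (c : R) : is_moment m (fun _ => c) (c * m 0%nat).
Proof.
  eapply is_lim_seq_ext; [|apply is_lim_seq_const].
  intro N; symmetry; apply (bern_const (S N) m c).
Qed.

Lemma is_moment_le (m : nat -> R) (phi psi : R -> R) (l l' : R) :
  hausdorff m -> (forall t, 0 <= t <= 1 -> phi t <= psi t) ->
  is_moment m phi l -> is_moment m psi l' -> l <= l'.
Proof.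
  intros Hm H H1 H2.
  apply (is_lim_seq_le (bernstein_mean m phi) (bernstein_mean m psi) l l'); auto.
  intro N; apply bern_le; [exact Hm|].
  intros k Hk; apply H, grid_in_unit, Hk.
Qed.

Lemma is_moment_abs_le (m : nat -> R) (phi : R -> R) (l e : R) :
  hausdorff m -> (forall t, 0 <= t <= 1 -> Rabs (phi t) <= e) ->
  is_moment m phi l -> Rabs l <= e * m 0%nat.
Proof.
  intros Hm H Hl; apply Rabs_le; split.
  - apply (is_moment_le m (fun _ => - e) phi); auto.
    + intros t Ht; specialize (H t Ht); apply Rabs_le_between in H; lra.
    + rewrite Ropp_mult_distr_l; apply is_moment_const.
  - apply (is_moment_le m phi (fun _ => e)); auto.
    + intros t Ht; specialize (H t Ht); apply Rabs_le_between in H; lra.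
    + apply is_moment_const.
Qed.

Lemma pow_unit (x : R) (n : nat) : 0 <= x <= 1 -> 0 <= x ^ n <= 1.
Proof.
  intro Hx; split; [apply pow_le; lra|].
  rewrite <- (pow1 n); apply pow_incr, Hx.
Qed.

Lemma pow_unit_lipschitz (x y : R) (n : nat) :
  0 <= x <= 1 -> 0 <= y <= 1 -> Rabs (x ^ n - y ^ n) <= INR n * Rabs (x - y).
Proof.
  intros Hx Hy; induction n as [|n IH].
  - simpl; rewrite Rminus_diag, Rabs_R0; lra.
  - rewrite S_INR; simpl pow.
    replace (x * x ^ n - y * y ^ n) with (x * (x ^ n - y ^ n) + (x - y) * y ^ n) by ring.
    eapply Rle_trans; [apply Rabs_triang|].
    rewrite !Rabs_mult, (Rabs_pos_eq x) by lra.
    rewrite (Rabs_pos_eq (y ^ n)) by apply (pow_unit y n Hy).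
    generalize (Rabs_pos (x - y)) (Rabs_pos (x ^ n - y ^ n)) (pow_unit y n Hy).
    intros; nra.
Qed.

(** By [bern_succ_success], one factor [k/(N+2)] is absorbed by shifting [m]. What remains is the
    mean of [t^n] for the shifted sequence, except that its grid points are [(k+1)/(N+2)] instead of
    [k/(N+1)]; these differ by at most [1/(N+1)]. *)
Lemma is_moment_pow (m : nat -> R) (n : nat) :
  hausdorff m -> is_moment m (fun t => t ^ n) (m n).
Proof.
  revert m; induction n as [|n IH]; intros m Hm.
  - simpl; rewrite <- (Rmult_1_l (m 0%nat)); apply is_moment_const.
  - specialize (IH _ (hausdorff_shift m Hm)); unfold is_moment in *.
    apply is_lim_seq_incr_1.
    apply (is_lim_seq_ext (fun N => bernstein_mean (fun i => m (S i)) (fun t => t ^ n) N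
      + (bernstein_mean m (fun t => t ^ S n) (S N)
         - bernstein_mean (fun i => m (S i)) (fun t => t ^ n) N))); [intro; ring|].
    replace (Finite (m (S n))) with (Finite (m (S n) + 0)) by (f_equal; ring).
    apply is_lim_seq_plus'; [exact IH|].
    apply is_lim_seq_abs_0.
    apply (is_lim_seq_le_le (fun _ => 0) _ (fun N => INR n * m 1%nat * / INR (S N))).
    + intro N; split; [apply Rabs_pos|].
      unfold bernstein_mean.
      assert (HN : 0 < INR (S N)) by (apply lt_0_INR; lia).
      assert (HN' : INR (S (S N)) = INR (S N) + 1) by apply S_INR.
      rewrite (bern_ext (S (S N)) m _ (fun k => / INR (S (S N)) * (INR k * (INR k / INR (S (S N))) ^ n)))
        by (intros k _; rewrite <- Rmult_assoc; cbn [pow]; f_equal; unfold Rdiv; ring).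
      rewrite bern_scal, bern_succ_success.
      rewrite <- Rmult_assoc, Rinv_l, Rmult_1_l by lra.
      replace (INR n * m 1%nat * / INR (S N)) with (INR n * / INR (S N) * m 1%nat) by ring.
      apply (bern_abs_le (S N) (fun i => m (S i))); [apply hausdorff_shift, Hm|].
      intros k Hk.
      eapply Rle_trans.
      { apply pow_unit_lipschitz; apply grid_in_unit; lia. }
      apply Rmult_le_compat_l; [apply pos_INR|].
      assert (INR k <= INR (S N)) by (apply le_INR, Hk).
      generalize (pos_INR k); intro.
      rewrite HN', (S_INR k).
      replace ((INR k + 1) / (INR (S N) + 1) - INR k / INR (S N)) with
        ((INR (S N) - INR k) / (INR (S N) + 1) * / INR (S N)) by (field; lra).
      assert (0 < / INR (S N)) by (apply Rinv_0_lt_compat; lra).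
      assert (0 <= (INR (S N) - INR k) / (INR (S N) + 1) <= 1).
      { split; [apply Rdiv_le_0_compat; lra|apply (Rdiv_le_1 (INR (S N) - INR k)); lra]. }
      rewrite Rabs_pos_eq by (apply Rmult_le_pos; lra); nra.
    + apply is_lim_seq_const.
    + replace (Finite 0) with (Rbar_mult (INR n * m 1%nat) 0) by (simpl; f_equal; ring).
      apply is_lim_seq_scal_l.
      replace (Finite 0) with (Rbar_inv p_infty) by reflexivity.
      apply is_lim_seq_inv; [|discriminate].
      apply (is_lim_seq_incr_1 INR), is_lim_seq_INR.
Qed.

Lemma is_moment_polynomial (m c : nat -> R) (n : nat) :
  hausdorff m ->
  is_moment m (fun t => sum_n (fun j => c j * t ^ j) n) (sum_n (fun j => c j * m j) n).
Proof.
  intro Hm; induction n as [|n IH].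
  - rewrite sum_O.
    apply (is_moment_ext m (fun t => c 0%nat * t ^ 0)).
    + intros t _; rewrite sum_O; reflexivity.
    + apply (is_moment_scal m (fun t => t ^ 0)), is_moment_pow, Hm.
  - rewrite sum_Sn.
    apply (is_moment_ext m (fun t => sum_n (fun j => c j * t ^ j) n + c (S n) * t ^ S n)).
    + intros t _; rewrite sum_Sn; reflexivity.
    + apply is_moment_plus; [exact IH|].
      apply (is_moment_scal m (fun t => t ^ S n)), is_moment_pow, Hm.
Qed.

(** Absolute summability of [c] makes the series converge uniformly on [0,1], and [is_moment_abs_le]
    turns the uniform error into an error of the functional. *)
Lemma is_series_moment (m c : nat -> R) (phi : R -> R) (l : R) :
  hausdorff m -> ex_series (fun n => Rabs (c n)) ->
  (forall t, 0 <= t <= 1 -> is_series (fun n => c n * t ^ n) (phi t)) ->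
  is_moment m phi l -> is_series (fun n => c n * m n) l.
Proof.
  intros Hm [s Hs] Hphi Hl.
  (* Weierstrass bound on the tail, obtained by letting [p] tend to infinity in the estimate between
     the partial sums [n] and [p]. *)
  assert (Rem : forall n t, 0 <= t <= 1 ->
     Rabs (phi t - sum_n (fun j => c j * t ^ j) n) <= s - sum_n (fun j => Rabs (c j)) n).
  { intros n t Ht.
    set (g := fun p : nat => sum_n (fun j => Rabs (c j)) p).
    set (h := fun p : nat => sum_n (fun j => c j * t ^ j) p).
    apply (is_lim_seq_le_loc (fun p => Rabs (h p - h n)) (fun p => g p - g n)
             (Rabs (phi t - h n)) (s - g n)).
    - exists n; intros p Hp.
      replace p with ((p - n) + n)%nat by lia; generalize (p - n)%nat; intro q.
      clear Hp; induction q as [|q IH].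
      + simpl; rewrite !Rminus_diag, Rabs_R0; lra.
      + unfold g, h in *; change (S q + n)%nat with (S (q + n)); rewrite !sum_Sn.
        change (@plus R_AbelianGroup) with Rplus.
        change (plus ?a ?b) with (a + b).
        match goal with |- Rabs (?a + ?b - ?d) <= _ =>
          replace (a + b - d) with ((a - d) + b) by ring end.
        assert (Rabs (c (S (q + n)) * t ^ S (q + n)) <= Rabs (c (S (q + n)))).
        { destruct (pow_unit t (S (q + n)) Ht) as [A1 A2].
          rewrite Rabs_mult, (Rabs_pos_eq (t ^ _)) by exact A1.
          generalize (Rmult_le_compat_l _ _ _ (Rabs_pos (c (S (q + n)))) A2); lra. }
        eapply Rle_trans; [apply Rabs_triang|]; lra.
    - apply (is_lim_seq_abs _ (phi t - h n)), is_lim_seq_minus'; [apply Hphi, Ht|apply is_lim_seq_const].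
    - apply is_lim_seq_minus'; [exact Hs|apply is_lim_seq_const]. }
  change (is_lim_seq (sum_n (fun j => c j * m j)) l).
  apply (is_lim_seq_ext (fun n => l + (sum_n (fun j => c j * m j) n - l)));
    [intro; ring|].
  replace (Finite l) with (Finite (l + 0)) by (f_equal; ring).
  apply is_lim_seq_plus'; [apply is_lim_seq_const|].
  apply is_lim_seq_abs_0.
  apply (is_lim_seq_le_le (fun _ => 0) _
           (fun n => (s - sum_n (fun j => Rabs (c j)) n) * m 0%nat)).
  - intro n; split; [apply Rabs_pos|].
    rewrite Rabs_minus_sym.
    apply (is_moment_abs_le m (fun t => phi t + -1 * sum_n (fun j => c j * t ^ j) n)); auto.
    + intros t Ht; specialize (Rem n t Ht).
      match goal with |- Rabs (?a + -1 * ?b) <= _ => replace (a + -1 * b) with (a - b) by ring end.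
      exact Rem.
    + replace (l - _) with (l + -1 * sum_n (fun j => c j * m j) n) by ring.
      apply is_moment_plus; [exact Hl|].
      apply is_moment_scal, is_moment_polynomial, Hm.
  - apply is_lim_seq_const.
  - replace (Finite 0) with (Finite ((s - s) * m 0%nat)) by (f_equal; ring).
    apply is_lim_seq_mult'; [|apply is_lim_seq_const].
    apply is_lim_seq_minus'; [apply is_lim_seq_const|exact Hs].
Qed.

(** * Differentiation under the moment functional *)

(** Two applications of the mean value theorem give [M] in place of the sharp [M/2]. The end points
    may come in either order. *)
Lemma second_order_bound (f df ddf : R -> R) (x y M : R) :
  (forall z, Rmin x y <= z <= Rmax x y -> is_derive f z (df z)) ->
  (forall z, Rmin x y <= z <= Rmax x y -> is_derive df z (ddf z)) ->
  (forall z, Rmin x y <= z <= Rmax x y -> Rabs (ddf z) <= M) ->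
  Rabs (f y - f x - df x * (y - x)) <= M * (y - x) ^ 2.
Proof.
  intros H1 H2 H3.
  assert (C1 : forall (g dg : R -> R) z, is_derive g z (dg z) -> continuity_pt g z).
  { intros g dg z Hz; apply continuity_pt_filterlim.
    apply (ex_derive_continuous g); eexists; apply Hz. }
  destruct (MVT_gen f x y df) as [c [Hc Ec]].
  { intros z Hz; apply H1; lra. }
  { intros z Hz; apply (C1 f df), H1, Hz. }
  assert (Hsub : forall z, Rmin x c <= z <= Rmax x c -> Rmin x y <= z <= Rmax x y).
  { intros z Hz; revert Hc Hz; unfold Rmin, Rmax.
    destruct (Rle_dec x y), (Rle_dec x c); lra. }
  destruct (MVT_gen df x c ddf) as [e [He Ee]].
  { intros z Hz; apply H2, Hsub; lra. }
  { intros z Hz; apply (C1 df ddf), H2, Hsub, Hz. }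
  rewrite Ec, <- Rmult_minus_distr_r, Ee, !Rabs_mult.
  specialize (H3 e (Hsub e He)).
  assert (Hcx : Rabs (c - x) <= Rabs (y - x)).
  { revert Hc; unfold Rmin, Rmax, Rabs.
    destruct (Rle_dec x y), (Rcase_abs (c - x)), (Rcase_abs (y - x)); lra. }
  rewrite <- (pow2_abs (y - x)).
  replace (M * Rabs (y - x) ^ 2) with (M * (Rabs (y - x) * Rabs (y - x))) by ring.
  rewrite Rmult_assoc.
  apply Rmult_le_compat; auto using Rabs_pos.
  - apply Rmult_le_pos; apply Rabs_pos.
  - apply Rmult_le_compat_r; [apply Rabs_pos|exact Hcx].
Qed.

(** A quadratic error can be transported through the functional by positivity; this recovers a
    derivative from it. *)
Lemma is_derive_quadratic (f : R -> R) (x d delta M : R) :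
  0 < delta ->
  (forall y, Rabs (y - x) < delta -> Rabs (f y - f x - d * (y - x)) <= M * (y - x) ^ 2) ->
  is_derive f x d.
Proof.
  intros Hd H; apply is_derive_Reals; intros eps Heps.
  assert (HM : 0 < Rabs M + 1) by (generalize (Rabs_pos M); lra).
  assert (Hmin : 0 < Rmin delta (eps / (Rabs M + 1))).
  { apply Rmin_pos; [exact Hd|apply Rdiv_lt_0_compat; lra]. }
  exists (mkposreal _ Hmin); simpl; intros h Hh Hlt.
  assert (A1 : Rabs h < delta) by (eapply Rlt_le_trans; [exact Hlt|apply Rmin_l]).
  assert (A2 : Rabs h < eps / (Rabs M + 1)) by (eapply Rlt_le_trans; [exact Hlt|apply Rmin_r]).
  specialize (H (x + h)); replace (x + h - x) with h in H by ring; specialize (H A1).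
  replace ((f (x + h) - f x) / h - d) with ((f (x + h) - f x - d * h) / h) by (field; exact Hh).
  assert (Hp : 0 < Rabs h) by (apply Rabs_pos_lt, Hh).
  rewrite Rabs_div by exact Hh.
  apply Rlt_div_l; [exact Hp|].
  apply Rlt_div_r in A2; [|exact HM].
  rewrite <- pow2_abs in H.
  generalize (Rle_abs M); intro; nra.
Qed.

Lemma tame_with_C2 (phi dphi ddphi : R -> R) (M : R) :
  0 <= M ->
  (forall t, 0 <= t <= 1 -> is_derive phi t (dphi t) /\ is_derive dphi t (ddphi t)
     /\ Rabs (phi t) <= M /\ Rabs (dphi t) <= M /\ Rabs (ddphi t) <= M) ->
  tame_with phi dphi M.
Proof.
  intros HM H; split; [exact HM|]; intros x Hx.
  split; [apply (H x Hx)|split; [apply (H x Hx)|]]; intros y Hy.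
  assert (B : forall z, Rmin x y <= z <= Rmax x y -> 0 <= z <= 1).
  { intros z; unfold Rmin, Rmax; destruct (Rle_dec x y); lra. }
  apply (second_order_bound phi dphi ddphi); intros z Hz; apply (H z), B, Hz.
Qed.

Lemma tame_with_mult (f df g dg : R -> R) (M N : R) :
  tame_with f df M -> tame_with g dg N ->
  tame_with (fun t => f t * g t) (fun t => df t * g t + f t * dg t) (4 * M * N).
Proof.
  intros [HM Hf] [HN Hg].
  assert (HMN : 0 <= M * N) by (apply Rmult_le_pos; assumption).
  assert (P : forall a b, Rabs a <= M -> Rabs b <= N -> Rabs (a * b) <= M * N).
  { intros a b Ha Hb; rewrite Rabs_mult; apply Rmult_le_compat; auto using Rabs_pos. }
  split; [lra|]; intros x Hx.
  destruct (Hf x Hx) as (F1 & F2 & F3), (Hg x Hx) as (G1 & G2 & G3).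
  split; [|split].
  - specialize (P _ _ F1 G1); lra.
  - eapply Rle_trans; [apply Rabs_triang|].
    generalize (P _ _ F2 G1) (P _ _ F1 G2); lra.
  - intros y Hy; specialize (F3 y Hy); specialize (G3 y Hy).
    destruct (Hf y Hy) as (F4 & _ & _).
    set (h := y - x) in *.
    assert (Hh : Rabs h <= 1) by (unfold h; apply Rabs_le; lra).
    assert (Hh2 : 0 <= h ^ 2) by apply pow2_ge_0.
    assert (Lf : Rabs (f y - f x) <= 2 * M * Rabs h).
    { replace (f y - f x) with ((f y - f x - df x * h) + df x * h) by ring.
      eapply Rle_trans; [apply Rabs_triang|].
      rewrite Rabs_mult; rewrite <- pow2_abs in F3.
      generalize (Rabs_pos h); intro.
      assert (Rabs h ^ 2 <= Rabs h) by (simpl; nra).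
      assert (Rabs (df x) * Rabs h <= M * Rabs h) by (apply Rmult_le_compat_r; assumption).
      assert (M * Rabs h ^ 2 <= M * Rabs h) by (apply Rmult_le_compat_l; assumption).
      lra. }
    (* The three terms are bounded by 1, 1 and 2 times [M N h^2], the last because both [f y - f x]
       and [dg x * h] are O(h). Hence the constant 4. *)
    replace (f y * g y - f x * g x - (df x * g x + f x * dg x) * h) with
      ((f y - f x - df x * h) * g x
       + (f y * (g y - g x - dg x * h) + (f y - f x) * (dg x * h))) by ring.
    eapply Rle_trans; [apply Rabs_triang|].
    eapply Rle_trans; [apply Rplus_le_compat_l, Rabs_triang|].
    rewrite !Rabs_mult.
    assert (Rabs (f y - f x - df x * h) * Rabs (g x) <= M * h ^ 2 * N)
      by (apply Rmult_le_compat; auto using Rabs_pos).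
    assert (Rabs (f y) * Rabs (g y - g x - dg x * h) <= M * (N * h ^ 2))
      by (apply Rmult_le_compat; auto using Rabs_pos).
    assert (Rabs (f y - f x) * (Rabs (dg x) * Rabs h) <= 2 * M * Rabs h * (N * Rabs h)).
    { apply Rmult_le_compat; auto using Rabs_pos.
      - apply Rmult_le_pos; apply Rabs_pos.
      - apply Rmult_le_compat_r; [apply Rabs_pos|assumption]. }
    replace (2 * M * Rabs h * (N * Rabs h)) with (2 * M * N * Rabs h ^ 2) in H1 by ring.
    rewrite pow2_abs in H1; lra.
Qed.

Lemma tame_mult (f g : R -> R) : tame f -> tame g -> tame (fun t => f t * g t).
Proof.
  intros [df [M Hf]] [dg [N Hg]]; eexists; eexists; eapply tame_with_mult; eassumption.
Qed.

Lemma tame_const (c : R) : tame (fun _ => c).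
Proof.
  exists (fun _ => 0), (Rabs c); split; [apply Rabs_pos|]; intros x Hx.
  split; [lra|split; [rewrite Rabs_R0; apply Rabs_pos|]]; intros y Hy.
  replace (c - c - 0 * (y - x)) with 0 by ring.
  rewrite Rabs_R0; apply Rmult_le_pos; [apply Rabs_pos|apply pow2_ge_0].
Qed.

Lemma tame_id : tame (fun t => t).
Proof.
  exists (fun _ => 1), 1; split; [lra|]; intros x Hx.
  rewrite (Rabs_pos_eq x), (Rabs_pos_eq 1) by lra.
  split; [lra|split; [lra|]]; intros y Hy.
  replace (y - x - 1 * (y - x)) with 0 by ring.
  rewrite Rabs_R0; generalize (pow2_ge_0 (y - x)); lra.
Qed.

Lemma tame_plus (f g : R -> R) : tame f -> tame g -> tame (fun t => f t + g t).
Proof.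
  intros [df [M [HM Hf]]] [dg [N [HN Hg]]].
  exists (fun t => df t + dg t), (M + N); split; [lra|]; intros x Hx.
  destruct (Hf x Hx) as (F1 & F2 & F3), (Hg x Hx) as (G1 & G2 & G3).
  split; [|split]; try (eapply Rle_trans; [apply Rabs_triang|lra]).
  intros y Hy; specialize (F3 y Hy); specialize (G3 y Hy).
  replace (f y + g y - (f x + g x) - (df x + dg x) * (y - x)) with
    ((f y - f x - df x * (y - x)) + (g y - g x - dg x * (y - x))) by ring.
  eapply Rle_trans; [apply Rabs_triang|lra].
Qed.

Lemma tame_pow (n : nat) : tame (fun t => t ^ n).
Proof.
  induction n as [|n IH]; simpl; [apply tame_const|].
  apply (tame_mult (fun t => t)); [apply tame_id|exact IH].
Qed.

(** The remainder is one function of [t], bounded by [M (y-x)^2] uniformly on [0,1], so its moment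
    is at most [m 0] times that. *)
Lemma is_derive_moment (m : nat -> R) (K : R -> R -> R) (dK : R -> R) (x delta M : R) :
  hausdorff m -> 0 < delta ->
  (forall y, Rabs (y - x) < delta -> tame (K y)) -> tame dK ->
  (forall y t, Rabs (y - x) < delta -> 0 <= t <= 1 ->
     Rabs (K y t - K x t - dK t * (y - x)) <= M * (y - x) ^ 2) ->
  is_derive (fun y => moment m (K y)) x (moment m dK).
Proof.
  intros Hm Hd HK HdK H.
  apply (is_derive_quadratic _ _ _ delta (M * m 0%nat)); [exact Hd|]; intros y Hy.
  replace (M * m 0%nat * (y - x) ^ 2) with (M * (y - x) ^ 2 * m 0%nat) by ring.
  apply (is_moment_abs_le m (fun t => K y t + (-1 * K x t + - (y - x) * dK t))); auto.
  - intros t Ht.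
    replace (K y t + (-1 * K x t + - (y - x) * dK t)) with
      (K y t - K x t - dK t * (y - x)) by ring.
    auto.
  - replace (moment m (K y) - moment m (K x) - moment m dK * (y - x)) with
      (moment m (K y) + (-1 * moment m (K x) + - (y - x) * moment m dK)) by ring.
    apply is_moment_plus; [apply moment_correct; auto|].
    apply is_moment_plus; apply is_moment_scal, moment_correct; auto.
    apply HK; rewrite Rminus_diag, Rabs_R0; exact Hd.
Qed.

Lemma completely_monotone_family (f : nat -> R -> R) :
  (forall j x, 0 < x -> 0 <= f j x) ->
  (forall j x, 0 < x -> is_derive (f j) x (- f (S j) x)) ->
  completely_monotone (f 0%nat).
Proof.
  intros Hpos Hd.
  assert (E : forall n x, 0 < x -> Derive_n (f 0%nat) n x = (-1) ^ n * f n x).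
  { induction n as [|n IH]; intros x Hx; simpl; [ring|].
    rewrite (Derive_ext_loc _ (fun y => (-1) ^ n * f n y)).
    - rewrite Derive_scal, (is_derive_unique _ _ _ (Hd n x Hx)); ring.
    (* The ball of radius [x] about [x] stays in the positive half-line, the only place where the
       family is controlled. *)
    - exists (mkposreal x Hx); intros y Hy; apply IH.
      change (Rabs (y - x) < x) in Hy; apply Rabs_lt_between in Hy; lra. }
  intros n x Hx; split.
  - destruct n as [|n]; simpl; [trivial|].
    apply (ex_derive_ext_loc (fun y => (-1) ^ n * f n y)).
    + exists (mkposreal x Hx); intros y Hy; symmetry; apply E.
      change (Rabs (y - x) < x) in Hy; apply Rabs_lt_between in Hy; lra.
    + apply ex_derive_scal; eexists; apply Hd, Hx.
  - rewrite E, <- Rmult_assoc, <- Rpow_mult_distr by exact Hx.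
    replace (-1 * -1) with 1 by ring; rewrite pow1, Rmult_1_l; apply Hpos, Hx.
Qed.

(** [k j] is [(-1)^j] times the [j]-th derivative of [k 0]. The format covers both [exp (-u)] and
    [(1+u)^(-sigma)]. *)
Definition bounded_cm_kernel (k : nat -> R -> R) (c : nat -> R) : Prop :=
  (forall j u, 0 <= u -> is_derive (k j) u (- k (S j) u)) /\
  (forall j u, 0 <= u -> 0 <= k j u <= c j).

Lemma kernel_bound_ge0 (k : nat -> R -> R) (c : nat -> R) (j : nat) :
  bounded_cm_kernel k c -> 0 <= c j.
Proof. intros [_ k_bound]; generalize (k_bound j 0 (Rle_refl 0)); lra. Qed.

Lemma is_derive_kernel_scal (k : nat -> R -> R) (c : nat -> R) (j : nat) (x t : R) :
  bounded_cm_kernel k c -> 0 <= x * t -> is_derive (fun s => k j (x * s)) t (- x * k (S j) (x * t)).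
Proof.
  intros [k_derive _] H.
  replace (- x * k (S j) (x * t)) with (x * - k (S j) (x * t)) by ring.
  apply (is_derive_comp (k j) (fun s => x * s)); [apply k_derive, H|].
  auto_derive; [trivial|ring].
Qed.

Lemma tame_kernel (k : nat -> R -> R) (c : nat -> R) (j : nat) (x : R) :
  bounded_cm_kernel k c -> 0 <= x -> tame (fun t => k j (x * t)).
Proof.
  intros Hk Hx; destruct (Hk) as [_ k_bound].
  set (M := c j + x * c (S j) + x ^ 2 * c (S (S j))).
  generalize (kernel_bound_ge0 k c j Hk) (kernel_bound_ge0 k c (S j) Hk)
    (kernel_bound_ge0 k c (S (S j)) Hk).
  intros C0 C1 C2.
  assert (0 <= x * c (S j)) by (apply Rmult_le_pos; assumption).
  assert (0 <= x ^ 2 * c (S (S j))) by (apply Rmult_le_pos; [apply pow2_ge_0|assumption]).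
  exists (fun t => - x * k (S j) (x * t)), M.
  apply (tame_with_C2 _ _ (fun t => x ^ 2 * k (S (S j)) (x * t))); [unfold M; lra|].
  intros t Ht.
  assert (Hxt : 0 <= x * t) by (apply Rmult_le_pos; lra).
  generalize (k_bound j _ Hxt) (k_bound (S j) _ Hxt) (k_bound (S (S j)) _ Hxt).
  intros B0 B1 B2.
  split; [apply (is_derive_kernel_scal k c); assumption|split].
  - replace (x ^ 2 * k (S (S j)) (x * t)) with (- x * (- x * k (S (S j)) (x * t))) by ring.
    apply (is_derive_scal (fun s => k (S j) (x * s)) t (- x)), (is_derive_kernel_scal k c); assumption.
  - assert (x * k (S j) (x * t) <= x * c (S j)) by (apply Rmult_le_compat_l; lra).
    assert (x ^ 2 * k (S (S j)) (x * t) <= x ^ 2 * c (S (S j)))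
      by (apply Rmult_le_compat_l; [apply pow2_ge_0|lra]).
    split; [rewrite Rabs_pos_eq; unfold M; lra|split].
    + rewrite Rabs_mult, Rabs_Ropp, !Rabs_pos_eq by lra; unfold M; lra.
    + rewrite Rabs_mult, !Rabs_pos_eq by (try apply pow2_ge_0; lra); unfold M; lra.
Qed.

Lemma completely_monotone_moment_kernel (k : nat -> R -> R) (c : nat -> R) (m : nat -> R) :
  bounded_cm_kernel k c -> hausdorff m -> completely_monotone (fun x => moment m (fun t => k 0%nat (x * t))).
Proof.
  intros Hk Hm; destruct (Hk) as [_ k_bound].
  assert (T : forall j x, 0 <= x -> tame (fun t => t ^ j * k j (x * t))).
  { intros j x Hx; apply (tame_mult (fun t => t ^ j)); [apply tame_pow|apply (tame_kernel k c); assumption]. }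
  (* Each derivative in [x] of [k 0 (x t)] brings out a factor [- t], so the [j]-th member of the
     family is the moment of [t^j k_j(x t)]. The factor [t ^ 0] keeps the family uniform and is
     removed at the end. *)
  assert (CM : completely_monotone (fun x => moment m (fun t => t ^ 0 * k 0%nat (x * t)))).
  { apply (completely_monotone_family (fun j x => moment m (fun t => t ^ j * k j (x * t)))).
    - intros j x Hx.
      apply (is_moment_le m (fun _ => 0) (fun t => t ^ j * k j (x * t)) 0); auto.
      + intros t Ht; apply Rmult_le_pos; [apply pow_le; lra|].
        apply k_bound, Rmult_le_pos; lra.
      + generalize (is_moment_const m 0); rewrite Rmult_0_l; auto.
      + apply moment_correct, T; auto; lra.
    - intros j x Hx.
      assert (E : - moment m (fun t => t ^ S j * k (S j) (x * t))
                  = moment m (fun t => -1 * (t ^ S j * k (S j) (x * t)))).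
      { symmetry; apply is_moment_unique.
        replace (- moment m (fun t => t ^ S j * k (S j) (x * t))) with
          (-1 * moment m (fun t => t ^ S j * k (S j) (x * t))) by ring.
        apply is_moment_scal, moment_correct, T; auto; lra. }
      rewrite E.
      apply (is_derive_moment m (fun y t => t ^ j * k j (y * t)) _ x x (c (S (S j)))); auto.
      + intros y Hy; apply T; apply Rabs_lt_between in Hy; lra.
      + apply (tame_mult (fun _ => -1)); [apply tame_const|apply T; lra].
      + intros y t Hy Ht; apply Rabs_lt_between in Hy.
        (* [is_derive_kernel_scal] is reused with [t] as the fixed factor and [y] as the variable,
           hence the order [t * y]. *)
        assert (S2 : Rabs (k j (t * y) - k j (t * x) - (- t * k (S j) (t * x)) * (y - x))
                <= c (S (S j)) * (y - x) ^ 2).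
        { assert (B : forall z, Rmin x y <= z <= Rmax x y -> 0 <= t * z).
          { intros z; unfold Rmin; destruct (Rle_dec x y); intro; apply Rmult_le_pos; lra. }
          apply (second_order_bound (fun y => k j (t * y)) (fun y => - t * k (S j) (t * y))
                   (fun y => - t * (- t * k (S (S j)) (t * y)))).
          - intros z Hz; apply (is_derive_kernel_scal k c); auto.
          - intros z Hz.
            apply (is_derive_scal (fun s => k (S j) (t * s)) z (- t)), (is_derive_kernel_scal k c); auto.
          - intros z Hz; generalize (k_bound (S (S j)) _ (B z Hz)); intro.
            replace (- t * (- t * k (S (S j)) (t * z))) with (t ^ 2 * k (S (S j)) (t * z)) by ring.
            generalize (pow_unit t 2 Ht); intro.
            rewrite Rabs_pos_eq by (apply Rmult_le_pos; lra); nra. }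
        rewrite !(Rmult_comm _ t).
        replace (t ^ j * k j (t * y) - t ^ j * k j (t * x) - -1 * (t ^ S j * k (S j) (t * x)) * (y - x))
          with (t ^ j * (k j (t * y) - k j (t * x) - - t * k (S j) (t * x) * (y - x)))
          by (simpl; ring).
        rewrite Rabs_mult, (Rabs_pos_eq (t ^ j)) by apply (pow_unit t j Ht).
        generalize (pow_unit t j Ht); intro P.
        eapply Rle_trans; [apply Rmult_le_compat_r; [apply Rabs_pos|apply P]|].
        rewrite Rmult_1_l; exact S2. }
  revert CM; unfold completely_monotone.
  intros CM n x Hx; specialize (CM n x Hx).
  assert (E : forall y, moment m (fun t => t ^ 0 * k 0%nat (y * t))
              = moment m (fun t => k 0%nat (y * t))).
  { intro y; unfold moment; f_equal; apply Lim_seq_ext; intro N.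
    apply bern_ext; intros i _; simpl; ring. }
  rewrite <- (Derive_n_ext _ _ n x E); split; [|apply CM].
  apply (ex_derive_n_ext _ _ n x E), CM.
Qed.

Lemma exp_kernel : bounded_cm_kernel (fun _ u => exp (- u)) (fun _ => 1).
Proof.
  split.
  - intros _ u _; auto_derive; [trivial|ring].
  - intros _ u Hu; split; [apply Rlt_le, exp_pos|apply exp_le_1; lra].
Qed.

Lemma completely_monotone_moment_power (m : nat -> R) (sigma : R) :
  0 < sigma -> hausdorff m ->
  completely_monotone (fun x => moment m (fun t => Rpower (1 + x * t) (- sigma))).
Proof.
  intros Hs Hm.
  assert (CM : completely_monotone
    (fun x => moment m (fun t => poch sigma 0 * Rpower (1 + x * t) (- (sigma + INR 0))))).
  { apply (completely_monotone_moment_kernel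
      (fun j u => poch sigma j * Rpower (1 + u) (- (sigma + INR j))) (fun j => poch sigma j)); auto; split.
    - intros j u Hu; unfold Rpower; auto_derive; [lra|].
      simpl poch; rewrite S_INR.
      replace (- (sigma + (INR j + 1)) * ln (1 + u)) with
        (- (sigma + INR j) * ln (1 + u) + - ln (1 + u)) by ring.
      rewrite (exp_plus _ (- ln (1 + u))), exp_Ropp, exp_ln by lra; field; lra.
    - intros j u Hu; generalize (poch_pos sigma j Hs); intro P.
      assert (0 < Rpower (1 + u) (- (sigma + INR j)) <= 1).
      { unfold Rpower; split; [apply exp_pos|].
        apply exp_le_1.
        assert (0 <= ln (1 + u)) by (rewrite <- ln_1; apply ln_le; lra).
        generalize (pos_INR j); nra. }
      nra. }
  intros n x Hx; specialize (CM n x Hx).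
  assert (E : forall y, moment m (fun t => poch sigma 0 * Rpower (1 + y * t) (- (sigma + INR 0)))
              = moment m (fun t => Rpower (1 + y * t) (- sigma))).
  { intro y; unfold moment; f_equal; apply Lim_seq_ext; intro N.
    apply bern_ext; intros i _; simpl; rewrite Rplus_0_r; ring. }
  rewrite <- (Derive_n_ext _ _ n x E); split; [|apply CM].
  apply (ex_derive_n_ext _ _ n x E), CM.
Qed.

(** * Complex powers on the plane cut along the nonpositive reals *)

(** [Re c + |c|] is nonnegative and vanishes exactly on the nonpositive real axis; it is also the
    denominator in [arg]. *)
Definition cut (c : C) : Prop := 0 < Re c + Cmod c.

(** The half-angle formula [tan (theta/2) = Im c / (Re c + |c|)] gives the principal argument by a
    single smooth expression on the whole cut plane. *)
Definition arg (c : C) : R := 2 * atan (Im c / (Re c + Cmod c)).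

Definition cpow (c : C) (a : R) : C :=
  (exp (a * ln (Cmod c)) * cos (a * arg c), exp (a * ln (Cmod c)) * sin (a * arg c)).

(* Only derivatives along real lines are needed: complex differentiability will
   come from a second-order estimate on segments. *)
Definition line (u v : C) (s : R) : C := (fst u + s * fst v, snd u + s * snd v).

Definition is_cderive (f : R -> C) (s : R) (d : C) : Prop :=
  is_derive (fun t => Re (f t)) s (Re d) /\ is_derive (fun t => Im (f t)) s (Im d).

Lemma is_cderive_mult (f g : R -> C) (s : R) (df dg : C) :
  is_cderive f s df -> is_cderive g s dg ->
  is_cderive (fun t => f t * g t)%C s (df * g s + f s * dg)%C.
Proof.
  intros [F1 F2] [G1 G2]; split.
  - replace (Re (df * g s + f s * dg)%C) with
      ((Re df * Re (g s) + Re (f s) * Re dg) - (Im df * Im (g s) + Im (f s) * Im dg))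
      by (unfold Re, Im; simpl; ring).
    apply (is_derive_minus (fun t => Re (f t) * Re (g t)) (fun t => Im (f t) * Im (g t)));
      [apply (is_derive_mult (fun t => Re (f t)) (fun t => Re (g t)))
      |apply (is_derive_mult (fun t => Im (f t)) (fun t => Im (g t)))]; auto using Rmult_comm.
  - replace (Im (df * g s + f s * dg)%C) with
      ((Re df * Im (g s) + Re (f s) * Im dg) + (Im df * Re (g s) + Im (f s) * Re dg))
      by (unfold Re, Im; simpl; ring).
    apply (is_derive_plus (fun t => Re (f t) * Im (g t)) (fun t => Im (f t) * Re (g t)));
      [apply (is_derive_mult (fun t => Re (f t)) (fun t => Im (g t)))
      |apply (is_derive_mult (fun t => Im (f t)) (fun t => Re (g t)))]; auto using Rmult_comm.
Qed.

Lemma is_cderive_ext (f g : R -> C) (s : R) (d e : C) :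
  (forall t, f t = g t) -> d = e -> is_cderive f s d -> is_cderive g s e.
Proof.
  intros E <- [H1 H2]; split;
    (eapply is_derive_ext; [intro t; simpl; rewrite <- E; reflexivity|assumption]).
Qed.

Lemma is_cderive_const (c : C) (s : R) : is_cderive (fun _ => c) s 0%C.
Proof. split; apply (is_derive_const (V := R_NormedModule)). Qed.

Lemma Cmod2 (c : C) : Cmod c ^ 2 = fst c ^ 2 + snd c ^ 2.
Proof. apply Cmod2_alt. Qed.

Lemma Re_Cdiv (v c : C) :
  Re (v / c)%C = (fst v * fst c + snd v * snd c) / (fst c ^ 2 + snd c ^ 2).
Proof. destruct v, c; unfold Re, Cdiv, Cinv, Cmult, Rdiv; simpl; ring. Qed.

Lemma Im_Cdiv (v c : C) :
  Im (v / c)%C = (snd v * fst c - fst v * snd c) / (fst c ^ 2 + snd c ^ 2).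
Proof. destruct v, c; unfold Im, Cdiv, Cinv, Cmult, Rdiv; simpl; ring. Qed.

Lemma cut_Cmod_pos (c : C) : cut c -> 0 < Cmod c.
Proof.
  unfold cut; intro H; generalize (Cmod_ge_0 c) (Rle_abs (Re c)) (re_le_Cmod c); lra.
Qed.

Lemma cut_neq_0 (c : C) : cut c -> c <> 0%C.
Proof. intro H; apply Cmod_gt_0, cut_Cmod_pos, H. Qed.

Lemma is_derive_Cmod_line (u v : C) (s : R) :
  0 < Cmod (line u v s) ->
  is_derive (fun t => Cmod (line u v t)) s
    ((fst (line u v s) * fst v + snd (line u v s) * snd v) / Cmod (line u v s)).
Proof.
  intro H; unfold Cmod in *; simpl in *; auto_derive.
  - match goal with |- 0 < ?x => destruct (Rlt_or_le 0 x) as [P|P]; [exact P|] end.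
    rewrite sqrt_neg_0 in H; [lra|]; simpl in *; lra.
  - field; lra.
Qed.

Lemma is_derive_ln_Cmod_line (u v : C) (s : R) :
  0 < Cmod (line u v s) ->
  is_derive (fun t => ln (Cmod (line u v t))) s (Re (v / line u v s)).
Proof.
  intro H.
  generalize (is_derive_Cmod_line u v s H) (Cmod2 (line u v s)); intros D E.
  assert (P : 0 < fst (line u v s) ^ 2 + snd (line u v s) ^ 2) by (rewrite <- E; nra).
  replace (Re (v / line u v s)) with
    ((fst (line u v s) * fst v + snd (line u v s) * snd v) / Cmod (line u v s)
      * / Cmod (line u v s)).
  - apply (is_derive_comp ln (fun t => Cmod (line u v t))); [|exact D].
    apply is_derive_Reals, derivable_pt_lim_ln, H.
  - transitivity ((fst (line u v s) * fst v + snd (line u v s) * snd v) / Cmod (line u v s) ^ 2);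
      [field; lra|].
    rewrite E, Re_Cdiv; f_equal; ring.
Qed.

Lemma is_derive_arg_line (u v : C) (s : R) :
  cut (line u v s) ->
  is_derive (fun t => arg (line u v t)) s (Im (v / line u v s)).
Proof.
  intro Hc; generalize (cut_Cmod_pos _ Hc); intro H.
  generalize (is_derive_Cmod_line u v s H) (Cmod2 (line u v s)); intros D E.
  assert (P : 0 < fst (line u v s) ^ 2 + snd (line u v s) ^ 2) by (rewrite <- E; nra).
  unfold cut, Re in Hc; unfold arg, Re.
  set (X := fst (line u v s)) in *; set (Y := snd (line u v s)) in *.
  set (r := Cmod (line u v s)) in *.
  set (dr := (X * fst v + Y * snd v) / r) in *.
  assert (DX : is_derive (fun t => fst (line u v t)) s (fst v)) by (unfold line; simpl; auto_derive; [trivial|ring]).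
  assert (DY : is_derive (fun t => Im (line u v t)) s (snd v)) by (unfold line; simpl; auto_derive; [trivial|ring]).
  assert (DXr : is_derive (fun t => fst (line u v t) + Cmod (line u v t)) s (fst v + dr))
    by (apply (is_derive_plus (fun t => fst (line u v t))); assumption).
  assert (DQ := is_derive_div _ _ s _ _ DY DXr (Rgt_not_eq _ _ Hc)).
  assert (DA : is_derive (fun t => atan (Im (line u v t) / (fst (line u v t) + Cmod (line u v t)))) s
     ((snd v * (X + r) - Y * (fst v + dr)) / (X + r) ^ 2 * / (1 + (Y / (X + r)) ^ 2))).
  { apply (is_derive_comp atan
      (fun t => Im (line u v t) / (fst (line u v t) + Cmod (line u v t)))); [|exact DQ].
    apply is_derive_Reals.
    apply (derivable_pt_lim_atan (Y / (X + r))). }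
  replace (Im (v / line u v s)) with
    (2 * ((snd v * (X + r) - Y * (fst v + dr)) / (X + r) ^ 2 * / (1 + (Y / (X + r)) ^ 2))).
  { apply (is_derive_scal (fun t => atan (Im (line u v t) / (fst (line u v t) + Cmod (line u v t))))); exact DA. }
  (* The half-angle identity, from [X^2 + Y^2 = r^2]; it clears the derivative of [atan] down to
     [Im (v/c)]. *)
  assert (D2 : (X + r) ^ 2 + Y ^ 2 = 2 * r * (X + r)) by nra.
  replace (/ (1 + (Y / (X + r)) ^ 2)) with ((X + r) ^ 2 / (2 * r * (X + r))).
  2:{ rewrite <- D2; field; split; [lra|].
      assert (0 < (X + r) ^ 2) by (apply pow_lt, Hc); generalize (pow2_ge_0 Y); lra. }
  transitivity ((snd v * X - fst v * Y) / r ^ 2).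
  - unfold dr.
    apply (Rmult_eq_reg_r (r ^ 2 * (X + r))); [|apply Rgt_not_eq, Rmult_lt_0_compat; [apply pow_lt|]; lra].
    transitivity (r * (snd v * (X + r) - fst v * Y) - (X * fst v + Y * snd v) * Y); [field; lra|].
    transitivity ((snd v * X - fst v * Y) * (X + r)); [|field; lra].
    assert (EY : Y ^ 2 = r ^ 2 - X ^ 2) by lra.
    replace (r * (snd v * (X + r) - fst v * Y) - (X * fst v + Y * snd v) * Y) with
      (r * (snd v * (X + r) - fst v * Y) - X * fst v * Y - snd v * Y ^ 2) by ring.
    rewrite EY; ring.
  - rewrite E, Im_Cdiv; reflexivity.
Qed.

Lemma Cmod_cpow (c : C) (a : R) : Cmod (cpow c a) = exp (a * ln (Cmod c)).
Proof.
  set (r := exp (a * ln (Cmod c))).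
  assert (Hr : 0 < r) by apply exp_pos.
  unfold cpow; fold r; unfold Cmod; simpl fst; simpl snd.
  rewrite <- (sqrt_pow2 r) at 3 by lra.
  f_equal.
  generalize (sin2_cos2 (a * arg c)); unfold Rsqr; intro T.
  transitivity (r ^ 2 * (sin (a * arg c) * sin (a * arg c) + cos (a * arg c) * cos (a * arg c)));
    [ring|rewrite T; ring].
Qed.

(** [ln |c|] and [arg c] are the two parts of the logarithm, whose derivative along the line is
    [v/c]; the power is the exponential of [a] times it. *)
Lemma is_cderive_cpow_line (u v : C) (a s : R) :
  cut (line u v s) ->
  is_cderive (fun t => cpow (line u v t) a) s
    (RtoC a * (v / line u v s) * cpow (line u v s) a)%C.
Proof.
  intro H.
  assert (DL := is_derive_ln_Cmod_line u v s (cut_Cmod_pos _ H)).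
  assert (DT := is_derive_arg_line u v s H).
  set (L := fun t => ln (Cmod (line u v t))) in *.
  set (T := fun t => arg (line u v t)) in *.
  set (w := (v / line u v s)%C) in *.
  assert (G : forall (g : R -> R) dg, is_derive g (a * T s) dg ->
     is_derive (fun t => exp (a * L t) * g (a * T t)) s
       (a * Re w * exp (a * L s) * g (a * T s) + exp (a * L s) * (a * Im w * dg))).
  { intros g dg Hg.
    apply (is_derive_mult (fun t => exp (a * L t)) (fun t => g (a * T t))); [| |exact Rmult_comm].
    - apply (is_derive_comp exp (fun t => a * L t)).
      + apply is_derive_Reals, derivable_pt_lim_exp.
      + apply is_derive_scal, DL.
    - apply (is_derive_comp g (fun t => a * T t)); [exact Hg|].
      apply is_derive_scal, DT. }
  split.
  - apply (is_derive_ext (fun t => exp (a * L t) * cos (a * T t))); [reflexivity|].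
    replace (Re (RtoC a * w * cpow (line u v s) a)) with
      (a * Re w * exp (a * L s) * cos (a * T s) + exp (a * L s) * (a * Im w * - sin (a * T s))).
    + apply G, is_derive_Reals, derivable_pt_lim_cos.
    + unfold cpow, L, T, Re, Im, RtoC, Cmult; simpl; ring.
  - apply (is_derive_ext (fun t => exp (a * L t) * sin (a * T t))); [reflexivity|].
    replace (Im (RtoC a * w * cpow (line u v s) a)) with
      (a * Re w * exp (a * L s) * sin (a * T s) + exp (a * L s) * (a * Im w * cos (a * T s))).
    + apply G, is_derive_Reals, derivable_pt_lim_sin.
    + unfold cpow, L, T, Re, Im, RtoC, Cmult; simpl; ring.
Qed.

Lemma is_cderive_div_line (u v : C) (s : R) :
  line u v s <> 0%C ->
  is_cderive (fun t => v / line u v t)%C s (- (v / line u v s * (v / line u v s)))%C.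
Proof.
  intro H.
  assert (P : 0 < fst (line u v s) ^ 2 + snd (line u v s) ^ 2).
  { rewrite <- Cmod2; apply pow_lt, Cmod_gt_0, H. }
  split; unfold Re, Im, Cdiv, Cinv, Cmult, Copp, line in *; simpl in *;
    auto_derive; try (split; [lra|trivial]); try lra; try (field; lra).
  all: repeat split; try lra.
Qed.

Lemma is_cderive2_cpow_line (u v : C) (a s : R) :
  cut (line u v s) ->
  is_cderive (fun t => RtoC a * (v / line u v t) * cpow (line u v t) a)%C s
    (RtoC (a * (a - 1)) * (v / line u v s * (v / line u v s)) * cpow (line u v s) a)%C.
Proof.
  intro H.
  eapply is_cderive_ext; [reflexivity| |].
  2:{ apply is_cderive_mult; [|apply is_cderive_cpow_line, H].
      apply is_cderive_mult; [apply is_cderive_const|].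
      apply is_cderive_div_line, cut_neq_0, H. }
  rewrite RtoC_mult, RtoC_minus; ring.
Qed.

Lemma Cmod_le_Re_Im (c : C) : Cmod c <= Rabs (Re c) + Rabs (Im c).
Proof.
  assert (H : Cmod c ^ 2 <= (Rabs (Re c) + Rabs (Im c)) ^ 2).
  { rewrite Cmod2_alt, <- (pow2_abs (Re c)), <- (pow2_abs (Im c)).
    generalize (Rabs_pos (Re c)) (Rabs_pos (Im c)); nra. }
  generalize (Cmod_ge_0 c) (Rabs_pos (Re c)) (Rabs_pos (Im c)); nra.
Qed.

Lemma im_le_Cmod (c : C) : Rabs (Im c) <= Cmod c.
Proof. eapply Rle_trans; [apply Rmax_r|apply Rmax_Cmod]. Qed.

Lemma exp_neg_ln_le (a d r : R) :
  a <= 0 -> 0 < d -> d <= r -> exp (a * ln r) <= exp (a * ln d).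
Proof.
  intros Ha Hd Hr; apply exp_le.
  assert (ln d <= ln r) by (apply ln_le; assumption); nra.
Qed.

(** Taylor estimate on the segment from [u] to [u + v]; the factor 2 comes from treating real and
    imaginary parts separately. With [u = 1 - z t] it serves for increments of [t] in [ctame_cpow]
    and of [z] in [ex_derive_power_moment]. *)
Lemma cpow_second_order (u v : C) (a d : R) :
  a <= 0 -> 0 < d ->
  (forall s, 0 <= s <= 1 -> cut (line u v s) /\ d <= Cmod (line u v s)) ->
  Cmod (cpow (line u v 1) a - cpow u a - RtoC a * (v / u) * cpow u a)%C
  <= 2 * (a * (a - 1) / d ^ 2 * exp (a * ln d)) * Cmod v ^ 2.
Proof.
  intros Ha Hd H.
  set (M := a * (a - 1) / d ^ 2 * exp (a * ln d) * Cmod v ^ 2).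
  assert (E0 : line u v 0 = u).
  { unfold line; destruct u; simpl; f_equal; ring. }
  assert (B : forall s, 0 <= s <= 1 ->
    Cmod (RtoC (a * (a - 1)) * (v / line u v s * (v / line u v s)) * cpow (line u v s) a) <= M).
  { intros s Hs; destruct (H s Hs) as [Hc Hm].
    rewrite !Cmod_mult, Cmod_R, Cmod_cpow, Cmod_div by (apply cut_neq_0, Hc).
    rewrite Rabs_pos_eq by nra.
    generalize (Cmod_ge_0 v) (exp_neg_ln_le a d _ Ha Hd Hm) (exp_pos (a * ln d))
      (exp_pos (a * ln (Cmod (line u v s)))).
    intros Hv He Hp Hq; unfold M.
    assert (I : Cmod v / Cmod (line u v s) <= Cmod v / d).
    { apply Rmult_le_compat_l; [exact Hv|]; apply Rinv_le_contravar; assumption. }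
    assert (I0 : 0 <= Cmod v / Cmod (line u v s)) by (apply Rdiv_le_0_compat; lra).
    replace (a * (a - 1) / d ^ 2 * exp (a * ln d) * Cmod v ^ 2) with
      (a * (a - 1) * (Cmod v / d * (Cmod v / d)) * exp (a * ln d)) by (field; lra).
    apply Rmult_le_compat; [|lra| |exact He].
    - apply Rmult_le_pos; [nra|apply Rmult_le_pos; exact I0].
    - apply Rmult_le_compat_l; [nra|apply Rmult_le_compat; assumption]. }
  assert (S : forall s, Rmin 0 1 <= s <= Rmax 0 1 -> 0 <= s <= 1).
  { intro s; rewrite Rmin_left, Rmax_right by lra; auto. }
  eapply Rle_trans; [apply Cmod_le_Re_Im|].
  replace (2 * (a * (a - 1) / d ^ 2 * exp (a * ln d)) * Cmod v ^ 2) with (M + M)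
    by (unfold M; ring).
  apply Rplus_le_compat.
  - generalize (second_order_bound (fun t => Re (cpow (line u v t) a))
      (fun t => Re (RtoC a * (v / line u v t) * cpow (line u v t) a)%C)
      (fun t => Re (RtoC (a * (a - 1)) * (v / line u v t * (v / line u v t)) * cpow (line u v t) a)%C)
      0 1 M); intro T.
    rewrite E0 in T.
    replace (M * (1 - 0) ^ 2) with M in T by ring.
    replace (Re (cpow (line u v 1) a - cpow u a - RtoC a * (v / u) * cpow u a)%C) with
      (Re (cpow (line u v 1) a) - Re (cpow u a) - Re (RtoC a * (v / u) * cpow u a)%C * (1 - 0))
      by (unfold Re; simpl; ring).
    apply T; intros z Hz; specialize (S z Hz).
    + apply is_cderive_cpow_line, H, S.
    + apply is_cderive2_cpow_line, H, S.
    + eapply Rle_trans; [apply re_le_Cmod|apply B, S].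
  - generalize (second_order_bound (fun t => Im (cpow (line u v t) a))
      (fun t => Im (RtoC a * (v / line u v t) * cpow (line u v t) a)%C)
      (fun t => Im (RtoC (a * (a - 1)) * (v / line u v t * (v / line u v t)) * cpow (line u v t) a)%C)
      0 1 M); intro T.
    rewrite E0 in T.
    replace (M * (1 - 0) ^ 2) with M in T by ring.
    replace (Im (cpow (line u v 1) a - cpow u a - RtoC a * (v / u) * cpow u a)%C) with
      (Im (cpow (line u v 1) a) - Im (cpow u a) - Im (RtoC a * (v / u) * cpow u a)%C * (1 - 0))
      by (unfold Im; simpl; ring).
    apply T; intros z Hz; specialize (S z Hz).
    + apply is_cderive_cpow_line, H, S.
    + apply is_cderive2_cpow_line, H, S.
    + eapply Rle_trans; [apply im_le_Cmod|apply B, S].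
Qed.

Lemma cpow_inv (c : C) (a : R) : (cpow c a * cpow c (- a) = 1)%C.
Proof.
  unfold cpow; rewrite !Ropp_mult_distr_l_reverse, cos_neg, sin_neg, exp_Ropp.
  assert (P := exp_pos (a * ln (Cmod c))).
  generalize (sin2_cos2 (a * arg c)); unfold Rsqr; intro T.
  unfold Cmult, RtoC; simpl; f_equal.
  - transitivity (sin (a * arg c) * sin (a * arg c) + cos (a * arg c) * cos (a * arg c));
      [field; lra|exact T].
  - field; lra.
Qed.

Lemma cpow_real (x a : R) : 0 < x -> cpow (RtoC x) a = RtoC (Rpower x a).
Proof.
  intro Hx; unfold cpow, arg; rewrite Cmod_R, Rabs_pos_eq by lra.
  unfold Re, Im, RtoC, Rpower; simpl.
  replace (0 / (x + x)) with 0 by (field; lra).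
  rewrite atan_0, !Rmult_0_r, cos_0, sin_0; f_equal; ring.
Qed.

(** * The moment of (1 - z t)^(-sigma) *)

Lemma cut_intro (c : C) : (Im c = 0 -> 0 < Re c) -> cut c.
Proof.
  intro H; unfold cut; destruct (Req_dec (Im c) 0) as [E|E].
  - generalize (H E) (Cmod_ge_0 c); lra.
  - assert (P : 0 < Im c ^ 2) by (rewrite <- pow2_abs; apply pow_lt, Rabs_pos_lt, E).
    generalize (Cmod2_alt c) (Cmod_ge_0 c); intros; nra.
Qed.

Lemma slit_plane_cut (z : C) (t : R) :
  slit_plane z -> 0 <= t <= 1 -> cut (1 - z * RtoC t)%C.
Proof.
  intros Hz Ht; apply cut_intro; unfold slit_plane, Re, Im in *; simpl; intro E.
  destruct (Rlt_or_le 0 (1 - fst z * t)) as [P|P]; [lra|exfalso].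
  assert (0 < t) by (destruct Ht as [[?|<-] ?]; lra).
  apply Hz; split; nra.
Qed.

Lemma slit_plane_dist (z : C) :
  slit_plane z ->
  exists d, 0 < d /\ forall t, 0 <= t <= 1 -> d <= Cmod (1 - z * RtoC t)%C.
Proof.
  intro Hz; destruct (Req_dec (Im z) 0) as [E|E].
  - assert (Hx : Re z < 1) by (destruct (Rlt_or_le (Re z) 1); [assumption|exfalso; apply Hz; split; assumption]).
    exists (Rmin 1 (1 - Re z)); split; [apply Rmin_pos; lra|]; intros t Ht.
    eapply Rle_trans; [|apply re_le_Cmod].
    eapply Rle_trans; [|apply Rle_abs].
    unfold Re in *; simpl.
    destruct (Rle_or_lt 0 (fst z)).
    + eapply Rle_trans; [apply Rmin_r|]; nra.
    + eapply Rle_trans; [apply Rmin_l|]; nra.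
  - assert (Hz0 : 0 < Cmod z).
    { eapply Rlt_le_trans; [apply Rabs_pos_lt, E|apply im_le_Cmod]. }
    exists (Rabs (Im z) / Cmod z); split.
    { apply Rdiv_lt_0_compat; [apply Rabs_pos_lt, E|exact Hz0]. }
    intros t Ht; apply Rle_div_l; [exact Hz0|].
    rewrite Rmult_comm, <- (Cmod_conj z), <- Cmod_mult, <- Rabs_Ropp.
    eapply Rle_trans; [|apply im_le_Cmod]; right; f_equal.
    unfold Im; simpl; ring.
Qed.

Lemma Cmod_triangle_inv (u v : C) : Cmod u - Cmod v <= Cmod (u + v)%C.
Proof.
  assert (H := Cmod_triangle (u + v) (- v)); rewrite Cmod_opp in H.
  replace (u + v + - v)%C with u in H by ring; lra.
Qed.

Lemma slit_plane_near (z h : C) (d : R) :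
  0 < d -> (forall t, 0 <= t <= 1 -> d <= Cmod (1 - z * RtoC t)%C) ->
  Cmod h <= d / 2 ->
  slit_plane (z + h)%C /\
  forall t, 0 <= t <= 1 -> d / 2 <= Cmod (1 - (z + h) * RtoC t)%C.
Proof.
  intros Hd H Hh.
  assert (B : forall t, 0 <= t <= 1 -> d / 2 <= Cmod (1 - (z + h) * RtoC t)%C).
  { intros t Ht; specialize (H t Ht).
    replace (1 - (z + h) * RtoC t)%C with ((1 - z * RtoC t) + - (h * RtoC t))%C by ring.
    eapply Rle_trans; [|apply Cmod_triangle_inv].
    rewrite Cmod_opp, Cmod_mult, Cmod_R, Rabs_pos_eq by lra.
    generalize (Cmod_ge_0 h); nra. }
  split; [|exact B]; intros [E1 E2].
  (* If [z + h] lay on the slit, [t = 1 / Re (z + h)] would be in [0,1] and annihilate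
     [1 - (z + h) t], against the lower bound. *)
  assert (Ht : 0 < / Re (z + h) <= 1).
  { split; [apply Rinv_0_lt_compat; lra|].
    rewrite <- Rinv_1; apply Rinv_le_contravar; lra. }
  specialize (B (/ Re (z + h)) (conj (Rlt_le _ _ (proj1 Ht)) (proj2 Ht))).
  replace (1 - (z + h) * RtoC (/ Re (z + h)))%C with (RtoC 0) in B.
  { rewrite Cmod_0 in B; lra. }
  apply injective_projections; unfold Re, Im in *; simpl in *; [field; lra|].
  rewrite E1; ring.
Qed.

Definition ctame (f : R -> C) : Prop :=
  tame (fun t => Re (f t)) /\ tame (fun t => Im (f t)).

Definition cmoment (m : nat -> R) (f : R -> C) : C :=
  (moment m (fun t => Re (f t)), moment m (fun t => Im (f t))).

Lemma ctame_intro (f df : R -> C) (M : R) :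
  0 <= M ->
  (forall x, 0 <= x <= 1 -> Cmod (f x) <= M /\ Cmod (df x) <= M /\
     forall y, 0 <= y <= 1 ->
       Cmod (f y - f x - df x * RtoC (y - x))%C <= M * (y - x) ^ 2) ->
  ctame f.
Proof.
  intros HM H; split.
  - exists (fun t => Re (df t)), M; split; [exact HM|]; intros x Hx.
    destruct (H x Hx) as (H1 & H2 & H3).
    split; [eapply Rle_trans; [apply re_le_Cmod|exact H1]|].
    split; [eapply Rle_trans; [apply re_le_Cmod|exact H2]|]; intros y Hy.
    eapply Rle_trans; [|apply (H3 y Hy)].
    eapply Rle_trans; [|apply re_le_Cmod]; right; f_equal.
    unfold Re; simpl; ring.
  - exists (fun t => Im (df t)), M; split; [exact HM|]; intros x Hx.
    destruct (H x Hx) as (H1 & H2 & H3).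
    split; [eapply Rle_trans; [apply im_le_Cmod|exact H1]|].
    split; [eapply Rle_trans; [apply im_le_Cmod|exact H2]|]; intros y Hy.
    eapply Rle_trans; [|apply (H3 y Hy)].
    eapply Rle_trans; [|apply im_le_Cmod]; right; f_equal.
    unfold Im; simpl; ring.
Qed.

Lemma ctame_mult (f g : R -> C) : ctame f -> ctame g -> ctame (fun t => f t * g t)%C.
Proof.
  assert (Hopp : forall p, tame p -> tame (fun t => -1 * p t))
    by (intros p Hp; apply (tame_mult (fun _ => -1)); [apply tame_const|exact Hp]).
  assert (Hext : forall p q : R -> R, (forall t, p t = q t) -> tame p -> tame q).
  { intros p q E [dp [M [HM Hp]]]; exists dp, M; split; [exact HM|].
    intros x Hx; rewrite <- E; destruct (Hp x Hx) as (A1 & A2 & A3).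
    split; [exact A1|split; [exact A2|]]; intros y Hy; rewrite <- E; auto. }
  intros [F1 F2] [G1 G2]; split.
  - apply (Hext (fun t => Re (f t) * Re (g t) + -1 * (Im (f t) * Im (g t)))).
    { intro t; unfold Re, Im; simpl; ring. }
    apply tame_plus; [apply tame_mult; assumption|].
    apply (Hopp (fun t => Im (f t) * Im (g t))), tame_mult; assumption.
  - apply (tame_plus (fun t => Re (f t) * Im (g t)) (fun t => Im (f t) * Re (g t)));
      apply tame_mult; assumption.
Qed.

Lemma line_segment (z : C) (x y s : R) :
  line (1 - z * RtoC x)%C (- (z * RtoC (y - x)))%C s
  = (1 - z * RtoC (x + s * (y - x)))%C.
Proof. apply injective_projections; simpl; ring. Qed.

Lemma ctame_cpow (z : C) (a : R) :
  a <= 0 -> slit_plane z -> ctame (fun t => cpow (1 - z * RtoC t)%C a).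
Proof.
  intros Ha Hz; destruct (slit_plane_dist z Hz) as [d [Hd H]].
  set (E := exp (a * ln d)).
  set (K := 2 * (a * (a - 1) / d ^ 2 * E) * Cmod z ^ 2).
  assert (HE : 0 < E) by apply exp_pos.
  assert (Hd2 : 0 < d ^ 2) by (apply pow_lt, Hd).
  assert (HK : 0 <= K).
  { unfold K; apply Rmult_le_pos; [|apply pow2_ge_0].
    apply Rmult_le_pos; [lra|].
    apply Rmult_le_pos; [apply Rdiv_le_0_compat; nra|lra]. }
  assert (HL : 0 <= - a * (Cmod z / d) * E).
  { apply Rmult_le_pos; [|lra]; apply Rmult_le_pos; [lra|].
    apply Rdiv_le_0_compat; [apply Cmod_ge_0|exact Hd]. }
  assert (B : forall t, 0 <= t <= 1 -> Cmod (cpow (1 - z * RtoC t) a) <= E).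
  { intros t Ht; rewrite Cmod_cpow; apply exp_neg_ln_le; auto. }
  apply (ctame_intro _
    (fun t => RtoC a * (- z / (1 - z * RtoC t)) * cpow (1 - z * RtoC t) a)%C
    (* The three summands bound the function, its slope and the coefficient of the remainder. *)
    (E + - a * (Cmod z / d) * E + K)); [lra|]; intros x Hx.
  split; [specialize (B x Hx); lra|split].
  - assert (Hc := slit_plane_cut z x Hz Hx).
    rewrite !Cmod_mult, Cmod_R, Cmod_div, Cmod_opp by (apply cut_neq_0, Hc).
    rewrite Rabs_left1 by exact Ha.
    assert (- a * (Cmod z / Cmod (1 - z * RtoC x)) * Cmod (cpow (1 - z * RtoC x) a)
            <= - a * (Cmod z / d) * E); [|lra].
    assert (I : Cmod z / Cmod (1 - z * RtoC x) <= Cmod z / d).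
    { apply Rmult_le_compat_l; [apply Cmod_ge_0|]; apply Rinv_le_contravar; auto. }
    apply Rmult_le_compat; [|apply Cmod_ge_0| |apply B, Hx].
    + apply Rmult_le_pos; [lra|].
      apply Rdiv_le_0_compat; [apply Cmod_ge_0|apply cut_Cmod_pos, Hc].
    + apply Rmult_le_compat_l; lra.
  - intros y Hy.
    assert (T := cpow_second_order (1 - z * RtoC x) (- (z * RtoC (y - x))) a d Ha Hd).
    rewrite line_segment in T.
    replace (x + 1 * (y - x)) with y in T by ring.
    rewrite Cmod_opp, Cmod_mult, Cmod_R in T.
    replace ((cpow (1 - z * RtoC y) a - cpow (1 - z * RtoC x) a
      - RtoC a * (- z / (1 - z * RtoC x)) * cpow (1 - z * RtoC x) a * RtoC (y - x)))%C with
      (cpow (1 - z * RtoC y) a - cpow (1 - z * RtoC x) a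
      - RtoC a * (- (z * RtoC (y - x)) / (1 - z * RtoC x)) * cpow (1 - z * RtoC x) a)%C
      by (unfold Cdiv; ring).
    eapply Rle_trans; [apply T|].
    + intros s Hs; rewrite line_segment.
      assert (0 <= x + s * (y - x) <= 1) by nra.
      split; [apply slit_plane_cut|apply H]; assumption.
    + rewrite Rpow_mult_distr, pow2_abs; fold E.
      replace (2 * (a * (a - 1) / d ^ 2 * E) * (Cmod z ^ 2 * (y - x) ^ 2)) with
        (K * (y - x) ^ 2) by (unfold K; ring).
      apply Rmult_le_compat_r; [apply pow2_ge_0|lra].
Qed.

Lemma ctame_inv (z : C) : slit_plane z -> ctame (fun t => / (1 - z * RtoC t))%C.
Proof.
  intro Hz; destruct (slit_plane_dist z Hz) as [d [Hd H]].
  assert (N : forall t, 0 <= t <= 1 -> (1 - z * RtoC t)%C <> 0%C)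
    by (intros t Ht; apply cut_neq_0, slit_plane_cut; assumption).
  assert (B : forall t, 0 <= t <= 1 -> 0 <= Cmod (/ (1 - z * RtoC t)) <= / d).
  { intros t Ht; split; [apply Cmod_ge_0|].
    rewrite Cmod_inv by auto; apply Rinv_le_contravar; auto. }
  assert (Hi : 0 < / d) by (apply Rinv_0_lt_compat, Hd).
  assert (Hz0 := Cmod_ge_0 z).
  assert (H2 : 0 <= Cmod z * (/ d * / d)) by (apply Rmult_le_pos; [|apply Rmult_le_pos]; lra).
  assert (H3 : 0 <= Cmod z ^ 2 * (/ d * / d * / d))
    by (apply Rmult_le_pos; [apply pow2_ge_0|repeat apply Rmult_le_pos; lra]).
  apply (ctame_intro _ (fun t => z * (/ (1 - z * RtoC t) * / (1 - z * RtoC t)))%C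
    (/ d + Cmod z * (/ d * / d) + Cmod z ^ 2 * (/ d * / d * / d))); [lra|].
  intros x Hx; assert (Bx := B x Hx).
  split; [lra|split].
  - rewrite !Cmod_mult.
    assert (Cmod z * (Cmod (/ (1 - z * RtoC x)) * Cmod (/ (1 - z * RtoC x)))
            <= Cmod z * (/ d * / d)); [|lra].
    apply Rmult_le_compat_l; [exact Hz0|]; apply Rmult_le_compat; lra.
  - intros y Hy; assert (By := B y Hy).
    (* The remainder is exact: with [w_t = 1 - z t] it equals [z^2 (y-x)^2 / (w_x^2 w_y)]. *)
    replace (/ (1 - z * RtoC y) - / (1 - z * RtoC x)
       - z * (/ (1 - z * RtoC x) * / (1 - z * RtoC x)) * RtoC (y - x))%C with
      (z * z * (RtoC (y - x) * RtoC (y - x)) *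
        (/ (1 - z * RtoC x) * / (1 - z * RtoC x) * / (1 - z * RtoC y)))%C.
    + rewrite !Cmod_mult, !Cmod_R.
      replace (Cmod z * Cmod z * (Rabs (y - x) * Rabs (y - x))) with
        (Cmod z ^ 2 * (y - x) ^ 2) by (rewrite <- (pow2_abs (y - x)); ring).
      assert (P : Cmod (/ (1 - z * RtoC x)) * Cmod (/ (1 - z * RtoC x)) * Cmod (/ (1 - z * RtoC y))
         <= / d * / d * / d).
      { apply Rmult_le_compat; try lra; [apply Rmult_le_pos; lra|].
        apply Rmult_le_compat; lra. }
      assert (Q : 0 <= Cmod z ^ 2 * (y - x) ^ 2) by (apply Rmult_le_pos; apply pow2_ge_0).
      generalize (Rmult_le_compat_l _ _ _ Q P) (pow2_ge_0 (y - x)); intros; nra.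
    + rewrite RtoC_minus; field; split; apply N; assumption.
Qed.

Lemma is_derive_C_quadratic (f : C -> C) (z D : C) (delta M : R) :
  0 < delta ->
  (forall h, Cmod h <= delta -> Cmod (f (z + h) - f z - h * D)%C <= M * Cmod h ^ 2) ->
  @is_derive C_AbsRing C_NormedModule f z D.
Proof.
  intros Hd H; split.
  - apply (is_linear_scal_l (K := C_AbsRing) (V := C_NormedModule)).
  - intros w Hw eps.
    assert (E : w = z) by (symmetry; apply (@is_filter_lim_locally_unique C_AbsRing (AbsRing_NormedModule C_AbsRing) z w Hw)).
    subst w.
    assert (HM : 0 < Rabs M + 1) by (generalize (Rabs_pos M); lra).
    assert (Hmin : 0 < Rmin delta (eps / (Rabs M + 1))).
    { apply Rmin_pos; [exact Hd|apply Rdiv_lt_0_compat; [apply cond_pos|lra]]. }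
    exists (mkposreal _ Hmin); intros y Hy.
    change (Cmod (y - z)%C < Rmin delta (eps / (Rabs M + 1))) in Hy.
    change (Cmod ((f y - f z) - (y - z) * D)%C <= eps * Cmod (y - z)%C).
    assert (A1 : Cmod (y - z)%C < delta) by (eapply Rlt_le_trans; [exact Hy|apply Rmin_l]).
    assert (A2 : Cmod (y - z)%C < eps / (Rabs M + 1)) by (eapply Rlt_le_trans; [exact Hy|apply Rmin_r]).
    specialize (H (y - z)%C (Rlt_le _ _ A1)).
    assert (Ey : forall u : C, (z + (u - z) = u)%C) by (intro; ring).
    rewrite Ey in H.
    eapply Rle_trans; [exact H|].
    apply Rlt_div_r in A2; [|exact HM].
    generalize (Rle_abs M) (Cmod_ge_0 (y - z)%C); intros; simpl; nra.
Qed.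

Definition power_moment (m : nat -> R) (sigma : R) (z : C) : C :=
  cmoment m (fun t => cpow (1 - z * RtoC t)%C (- sigma)).

Lemma ex_derive_power_moment (m : nat -> R) (sigma : R) (z : C) :
  0 < sigma -> hausdorff m -> slit_plane z ->
  @ex_derive C_AbsRing C_NormedModule (power_moment m sigma) z.
Proof.
  intros Hs Hm Hz; destruct (slit_plane_dist z Hz) as [d [Hd H]].
  set (a := - sigma); assert (Ha : a <= 0) by (unfold a; lra).
  (* The derivative of [(1 - z t)^a] in [z], arranged as a product of three factors already known to
     be [ctame]. *)
  set (D := fun t : R => ((RtoC a * RtoC (- t)) * / (1 - z * RtoC t)
              * cpow (1 - z * RtoC t) a)%C).
  assert (TD : ctame D).
  { apply ctame_mult; [|apply ctame_cpow; assumption].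
    apply ctame_mult; [|apply ctame_inv, Hz].
    apply ctame_mult.
    - split; apply (tame_const _).
    - split; [|apply (tame_const 0)].
      simpl; destruct (tame_mult (fun _ => -1) _ (tame_const _) tame_id) as [dp [M [HM Hp]]].
      exists dp, M; split; [exact HM|]; intros x Hx; destruct (Hp x Hx) as (A1 & A2 & A3).
      replace (- x) with (-1 * x) by ring.
      split; [exact A1|split; [exact A2|]]; intros y Hy.
      replace (- y) with (-1 * y) by ring; auto. }
  (* The constant of [cpow_second_order] with [d / 2], the lower bound on [|1 - (z + s h) t|] given
     by [slit_plane_near]. *)
  set (K := 2 * (a * (a - 1) / (d / 2) ^ 2 * exp (a * ln (d / 2)))).
  exists (cmoment m D).
  apply (is_derive_C_quadratic _ z _ (d / 2) (2 * (K * m 0%nat))); [lra|].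
  intros h Hh.
  destruct (slit_plane_near z h d Hd H Hh) as [Hzh _].
  destruct (ctame_cpow z a Ha Hz) as [T1 T2].
  destruct (ctame_cpow (z + h) a Ha Hzh) as [T3 T4].
  destruct TD as [T5 T6].
  assert (Q : forall t, 0 <= t <= 1 ->
    Cmod (cpow (1 - (z + h) * RtoC t) a - cpow (1 - z * RtoC t) a - h * D t)%C
    <= K * Cmod h ^ 2).
  { intros t Ht.
    assert (T := cpow_second_order (1 - z * RtoC t) (- (h * RtoC t)) a (d / 2) Ha).
    assert (L : forall s, line (1 - z * RtoC t) (- (h * RtoC t)) s
                = (1 - (z + RtoC s * h) * RtoC t)%C)
      by (intro s; apply injective_projections; simpl; ring).
    rewrite L in T.
    replace (z + RtoC 1 * h)%C with (z + h)%C in T by ring.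
    replace (h * D t)%C with
      (RtoC a * (- (h * RtoC t) / (1 - z * RtoC t)) * cpow (1 - z * RtoC t) a)%C
      by (unfold D, Cdiv; rewrite RtoC_opp; ring).
    eapply Rle_trans; [apply T; [lra|]|].
    - intros s Hs'; rewrite L.
      destruct (slit_plane_near z (RtoC s * h) d Hd H) as [N1 N2].
      { rewrite Cmod_mult, Cmod_R, Rabs_pos_eq by lra.
        generalize (Cmod_ge_0 h); nra. }
      split; [apply slit_plane_cut; assumption|apply N2, Ht].
    - fold K; rewrite Cmod_opp, Cmod_mult, Cmod_R, Rabs_pos_eq by lra.
      assert (0 <= K).
      { unfold K; apply Rmult_le_pos; [lra|apply Rmult_le_pos; [|apply Rlt_le, exp_pos]].
        apply Rdiv_le_0_compat; [nra|apply pow_lt; lra]. }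
      apply Rmult_le_compat_l; [assumption|].
      generalize (Cmod_ge_0 h); intro.
      apply pow_incr; nra. }
  eapply Rle_trans; [apply Cmod_le_Re_Im|].
  replace (2 * (K * m 0%nat) * Cmod h ^ 2) with
    (K * Cmod h ^ 2 * m 0%nat + K * Cmod h ^ 2 * m 0%nat) by ring.
  apply Rplus_le_compat.
  - apply (is_moment_abs_le m
      (fun t => Re (cpow (1 - (z + h) * RtoC t) a) + (-1 * Re (cpow (1 - z * RtoC t) a)
         + (- Re h * Re (D t) + Im h * Im (D t))))); auto.
    + intros t Ht; eapply Rle_trans; [|apply (Q t Ht)].
      eapply Rle_trans; [|apply re_le_Cmod]; right; f_equal; unfold Re, Im; simpl; ring.
    + match goal with |- is_moment _ _ ?l => replace l with (moment m (fun t => Re (cpow (1 - (z + h) * RtoC t) a))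
         + (-1 * moment m (fun t => Re (cpow (1 - z * RtoC t) a))
         + (- Re h * moment m (fun t => Re (D t)) + Im h * moment m (fun t => Im (D t)))))
        by (unfold power_moment, cmoment; fold a; simpl; unfold Re, Im; ring) end.
      repeat apply is_moment_plus; try apply is_moment_scal; apply moment_correct; assumption.
  - apply (is_moment_abs_le m
      (fun t => Im (cpow (1 - (z + h) * RtoC t) a) + (-1 * Im (cpow (1 - z * RtoC t) a)
         + (- Re h * Im (D t) + - Im h * Re (D t))))); auto.
    + intros t Ht; eapply Rle_trans; [|apply (Q t Ht)].
      eapply Rle_trans; [|apply im_le_Cmod]; right; f_equal; unfold Re, Im; simpl; ring.
    + match goal with |- is_moment _ _ ?l => replace l with (moment m (fun t => Im (cpow (1 - (z + h) * RtoC t) a))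
         + (-1 * moment m (fun t => Im (cpow (1 - z * RtoC t) a))
         + (- Re h * moment m (fun t => Im (D t)) + - Im h * moment m (fun t => Re (D t)))))
        by (unfold power_moment, cmoment; fold a; simpl; unfold Re, Im; ring) end.
      repeat apply is_moment_plus; try apply is_moment_scal; apply moment_correct; assumption.
Qed.

(** * The binomial series *)

Definition binom_coef (sigma : R) (n : nat) : R := poch sigma n / INR (fact n).

Lemma binom_coef_pos (sigma : R) (n : nat) : 0 < sigma -> 0 < binom_coef sigma n.
Proof.
  intro H; apply Rdiv_lt_0_compat; [apply poch_pos, H|apply INR_fact_lt_0].
Qed.

Lemma binom_coef_succ (sigma : R) (n : nat) :
  INR (S n) * binom_coef sigma (S n) = (sigma + INR n) * binom_coef sigma n.
Proof.
  unfold binom_coef; simpl poch.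
  rewrite fact_simpl, mult_INR; field.
  split; [apply INR_fact_neq_0|apply not_0_INR; lia].
Qed.

Lemma CV_radius_binom (sigma : R) : 0 < sigma -> CV_radius (binom_coef sigma) = 1.
Proof.
  intro Hs; rewrite <- Rinv_1.
  assert (P : forall n, 0 < binom_coef sigma n) by (intro; apply binom_coef_pos, Hs).
  apply CV_radius_finite_DAlembert; [|lra|].
  - intro n; generalize (P n); lra.
  - apply (is_lim_seq_ext (fun n => 1 + (sigma - 1) * / INR (S n))).
    + intro n; assert (Hn : 0 < INR (S n)) by (apply lt_0_INR; lia).
      rewrite Rabs_pos_eq by (apply Rlt_le, Rdiv_lt_0_compat; apply P).
      apply (Rmult_eq_reg_l (INR (S n) * binom_coef sigma n)).
      2:{ apply Rgt_not_eq, Rmult_lt_0_compat; auto. }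
      transitivity ((sigma + INR n) * binom_coef sigma n).
      * rewrite S_INR in *; field; lra.
      * rewrite <- binom_coef_succ; field; generalize (P n); lra.
    + replace (Finite 1) with (Finite (1 + (sigma - 1) * 0)) by (f_equal; ring).
      apply is_lim_seq_plus'; [apply is_lim_seq_const|].
      apply is_lim_seq_mult'; [apply is_lim_seq_const|].
      replace (Finite 0) with (Rbar_inv p_infty) by reflexivity.
      apply is_lim_seq_inv; [|discriminate].
      apply (is_lim_seq_incr_1 INR), is_lim_seq_INR.
Qed.

(** A radius strictly above 1 puts the closed interval [0,1] inside the disk, so the series can be
    differentiated up to [t = 1]. *)
Lemma CV_radius_gt_1 (sigma rho : R) (b : nat -> R) :
  0 < sigma -> 0 <= rho < 1 ->
  (forall n, Rabs (b n) <= binom_coef sigma n * rho ^ n) -> Rbar_lt 1 (CV_radius b).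
Proof.
  intros Hs Hr Hb.
  (* [1/r] is the midpoint of [rho] and 1, so [r > 1] while [rho r < 1]. *)
  set (r := 2 / (1 + rho)).
  assert (Hr1 : 1 < r) by (apply Rlt_div_r; lra).
  assert (Hq : 0 <= rho * r < 1).
  { split; [apply Rmult_le_pos; lra|].
    unfold r, Rdiv; rewrite <- Rmult_assoc; apply Rlt_div_l; lra. }
  assert (Hex : ex_series (fun n => Rabs (binom_coef sigma n * (rho * r) ^ n))).
  { apply CV_disk_inside; rewrite CV_radius_binom by exact Hs.
    simpl; rewrite Rabs_pos_eq; lra. }
  apply ex_series_lim_0 in Hex.
  destruct (filterlim_bounded _ (ex_intro _ 0 Hex)) as [M HM].
  apply (Rbar_lt_le_trans 1 r); [exact Hr1|].
  apply (proj1 (CV_radius_bounded b)); exists M; intro n.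
  specialize (HM n); change (Rabs (Rabs (binom_coef sigma n * (rho * r) ^ n)) <= M) in HM.
  rewrite Rabs_Rabsolu in HM.
  eapply Rle_trans; [|exact HM].
  rewrite !Rabs_mult, Rpow_mult_distr.
  rewrite Rabs_mult, (Rabs_pos_eq (binom_coef sigma n)), (Rabs_pos_eq (rho ^ n))
    by (try apply Rlt_le, binom_coef_pos, Hs; apply pow_le; lra).
  rewrite <- Rmult_assoc; apply Rmult_le_compat_r; [apply Rabs_pos|apply Hb].
Qed.

Lemma line_one (z : C) (t : R) : line 1 (- z)%C t = (1 - z * RtoC t)%C.
Proof. apply injective_projections; simpl; ring. Qed.

Lemma Re_Cpow_bound (z : C) (n : nat) : Rabs (Re (z ^ n)%C) <= Cmod z ^ n.
Proof. rewrite <- Cmod_pow; apply re_le_Cmod. Qed.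

Lemma Im_Cpow_bound (z : C) (n : nat) : Rabs (Im (z ^ n)%C) <= Cmod z ^ n.
Proof. rewrite <- Cmod_pow; apply im_le_Cmod. Qed.

(* Along the ray [t |-> zt] the sum [S] of the series satisfies
   [(1 - zt) S' = sigma z S], so [S (1 - zt)^sigma] is constant. *)
Lemma binomial_series_ray (sigma : R) (z : C) :
  0 < sigma -> Cmod z < 1 ->
  let b n := binom_coef sigma n * Re (z ^ n)%C in
  let b' n := binom_coef sigma n * Im (z ^ n)%C in
  Rbar_lt 1 (CV_radius b) /\ Rbar_lt 1 (CV_radius b') /\
  forall t, 0 <= t <= 1 ->
    cpow (1 - z * RtoC t)%C (- sigma) = (PSeries b t, PSeries b' t).
Proof.
  intros Hs Hz b b'.
  assert (Hz' : 0 <= Cmod z < 1) by (split; [apply Cmod_ge_0|exact Hz]).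
  assert (Bb : forall x n, Rabs x <= Cmod z ^ n ->
     Rabs (binom_coef sigma n * x) <= binom_coef sigma n * Cmod z ^ n).
  { intros x n Hx; assert (P := binom_coef_pos sigma n Hs).
    rewrite Rabs_mult, (Rabs_pos_eq (binom_coef sigma n)) by lra.
    apply Rmult_le_compat_l; lra. }
  assert (R1 : Rbar_lt 1 (CV_radius b)).
  { apply (CV_radius_gt_1 sigma (Cmod z)); auto; intro n; apply Bb, Re_Cpow_bound. }
  assert (R2 : Rbar_lt 1 (CV_radius b')).
  { apply (CV_radius_gt_1 sigma (Cmod z)); auto; intro n; apply Bb, Im_Cpow_bound. }
  split; [exact R1|split; [exact R2|]].
  assert (Rad : forall c t, 0 <= t <= 1 -> Rbar_lt 1 (CV_radius c) -> Rbar_lt (Rabs t) (CV_radius c)).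
  { intros c t Ht Hc; rewrite Rabs_pos_eq by lra.
    apply (Rbar_le_lt_trans t 1); [simpl; lra|exact Hc]. }
  assert (Hb : forall n, PS_derive b n =
     (sigma + INR n) * binom_coef sigma n * (Re z * Re (z ^ n)%C - Im z * Im (z ^ n)%C)).
  { intro n; unfold PS_derive, b; rewrite <- Rmult_assoc, binom_coef_succ; reflexivity. }
  assert (Hb' : forall n, PS_derive b' n =
     (sigma + INR n) * binom_coef sigma n * (Re z * Im (z ^ n)%C + Im z * Re (z ^ n)%C)).
  { intro n; unfold PS_derive, b'; rewrite <- Rmult_assoc, binom_coef_succ; reflexivity. }
  (* [PS_incr_1 (PS_derive c)] is the coefficient sequence of [t S'(t)]. *)
  assert (Hn : forall c n, c = b \/ c = b' -> PS_incr_1 (PS_derive c) n = INR n * c n).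
  { intros c [|n] _; [simpl; unfold zero; simpl; ring|reflexivity]. }
  set (s := fun t => (PSeries b t, PSeries b' t) : C).
  set (ds := fun t => (PSeries (PS_derive b) t, PSeries (PS_derive b') t) : C).
  (* This is the recursion [(n+1) c_(n+1) = (sigma+n) c_n] of the binomial coefficients, summed
     against [z^(n+1) t^n]. *)
  assert (ODE : forall t, 0 <= t <= 1 -> ds t = (z * (RtoC sigma * s t + RtoC t * ds t))%C).
  { intros t Ht.
    assert (E1 := PSeries_correct _ _ (CV_radius_inside b t (Rad b t Ht R1))).
    assert (E2 := PSeries_correct _ _ (CV_radius_inside b' t (Rad b' t Ht R2))).
    assert (E3 := PSeries_correct _ _ (ex_pseries_derive b t (Rad b t Ht R1))).
    assert (E4 := PSeries_correct _ _ (ex_pseries_derive b' t (Rad b' t Ht R2))).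
    assert (F : forall c v dv, is_pseries c t v -> is_pseries (PS_derive c) t dv ->
       is_pseries (PS_plus (PS_scal sigma c) (PS_incr_1 (PS_derive c))) t (sigma * v + t * dv)).
    { intros c v dv Hv Hdv.
      apply (@is_pseries_plus R_AbsRing R_NormedModule _ _ t (sigma * v) (t * dv)).
      - apply (is_pseries_scal sigma c t v); [apply Rmult_comm|exact Hv].
      - apply (is_pseries_incr_1 (PS_derive c) t dv), Hdv. }
    assert (F1 := F b _ _ E1 E3); assert (F2 := F b' _ _ E2 E4); clear F.
    assert (G : forall x y,
      is_pseries (PS_plus (PS_scal x (PS_plus (PS_scal sigma b) (PS_incr_1 (PS_derive b))))
          (PS_scal y (PS_plus (PS_scal sigma b') (PS_incr_1 (PS_derive b'))))) t
        (x * (sigma * PSeries b t + t * PSeries (PS_derive b) t)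
         + y * (sigma * PSeries b' t + t * PSeries (PS_derive b') t))).
    { intros x y.
      apply (@is_pseries_plus R_AbsRing R_NormedModule _ _ t
        (x * (sigma * PSeries b t + t * PSeries (PS_derive b) t))
        (y * (sigma * PSeries b' t + t * PSeries (PS_derive b') t)));
        apply (@is_pseries_scal R_AbsRing R_NormedModule); auto using Rmult_comm. }
    apply injective_projections; simpl.
    - transitivity (Re z * (sigma * PSeries b t + t * PSeries (PS_derive b) t)
         + - Im z * (sigma * PSeries b' t + t * PSeries (PS_derive b') t));
        [|unfold Re, Im; ring].
      rewrite <- (is_pseries_unique _ _ _ (G (Re z) (- Im z))).
      apply PSeries_ext; intro n; rewrite Hb.
      unfold PS_plus, PS_scal; rewrite !Hn by auto.
      unfold plus, scal, b, b'; simpl; unfold mult; simpl; ring.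
    - transitivity (Im z * (sigma * PSeries b t + t * PSeries (PS_derive b) t)
         + Re z * (sigma * PSeries b' t + t * PSeries (PS_derive b') t));
        [|unfold Re, Im; ring].
      rewrite <- (is_pseries_unique _ _ _ (G (Im z) (Re z))).
      apply PSeries_ext; intro n; rewrite Hb'.
      unfold PS_plus, PS_scal; rewrite !Hn by auto.
      unfold plus, scal, b, b'; simpl; unfold mult; simpl; ring. }
  assert (Hslit : slit_plane z).
  { intros [_ H]; generalize (re_le_Cmod z) (Rle_abs (Re z)); lra. }
  set (g := fun t => (s t * cpow (line 1 (- z) t) sigma)%C).
  assert (Dg : forall t, 0 <= t <= 1 -> is_cderive g t 0%C).
  { intros t Ht.
    assert (Hc := slit_plane_cut z t Hslit Ht).
    assert (Hc' : cut (line 1 (- z) t)) by (rewrite line_one; exact Hc).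
    eapply is_cderive_ext; [reflexivity| |apply is_cderive_mult;
      [|apply is_cderive_cpow_line, Hc']].
    2:{ instantiate (1 := ds t); split; simpl; apply is_derive_PSeries; apply Rad; assumption. }
    rewrite line_one in *.
    assert (N := cut_neq_0 _ Hc).
    assert (E : ds t = (RtoC sigma * z * s t / (1 - z * RtoC t))%C).
    { assert (O : ((1 - z * RtoC t) * ds t = RtoC sigma * z * s t)%C).
      { transitivity (ds t - z * RtoC t * ds t)%C; [ring|].
        rewrite (ODE t Ht) at 1; ring. }
      rewrite <- O; field; exact N. }
    cbv beta; rewrite line_one, E; field; exact N. }
  assert (G0 : g 0 = 1%C).
  { unfold g, s; rewrite line_one, !PSeries_0.
    replace (1 - z * 0)%C with (RtoC 1) by ring.
    rewrite cpow_real by lra.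
    unfold Rpower; rewrite ln_1, (Rmult_0_r sigma), exp_0; unfold b, b', binom_coef; simpl.
    apply injective_projections; simpl; field. }
  intros t Ht.
  assert (Gt : g t = 1%C).
  { rewrite <- G0.
    assert (Z : forall f : R -> R, (forall y, 0 <= y <= 1 -> is_derive f y 0) -> f t = f 0).
    { intros f Hf.
      assert (B : forall y, Rmin 0 t <= y <= Rmax 0 t -> 0 <= y <= 1)
        by (intro y; rewrite Rmin_left, Rmax_right by lra; lra).
      (* With second derivative bound 0, the Taylor estimate says that a function with zero
         derivative is constant. *)
      assert (Q := second_order_bound f (fun _ => 0) (fun _ => 0) 0 t 0).
      assert (Rabs (f t - f 0 - 0 * (t - 0)) <= 0 * (t - 0) ^ 2).
      { apply Q; intros y Hy.
        - apply Hf, B, Hy.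
        - apply (is_derive_const (V := R_NormedModule)).
        - rewrite Rabs_R0; lra. }
      rewrite Rmult_0_l in H; apply Rabs_le_between in H; lra. }
    apply injective_projections.
    - apply (Z (fun y => Re (g y))); intros y Hy; apply (Dg y Hy).
    - apply (Z (fun y => Im (g y))); intros y Hy; apply (Dg y Hy). }
  transitivity (g t * cpow (1 - z * RtoC t) (- sigma))%C; [rewrite Gt; ring|].
  unfold g; rewrite line_one.
  transitivity (s t * (cpow (1 - z * RtoC t) sigma * cpow (1 - z * RtoC t) (- sigma)))%C; [ring|].
  rewrite cpow_inv; unfold s; ring.
Qed.

Lemma is_series_C (a : nat -> C) (l : C) :
  is_series (fun n => Re (a n)) (Re l) -> is_series (fun n => Im (a n)) (Im l) ->
  @is_series C_AbsRing C_NormedModule a l.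
Proof.
  intros H1 H2.
  assert (E : forall n, sum_n a n = (sum_n (fun k => Re (a k)) n, sum_n (fun k => Im (a k)) n)).
  { induction n as [|n IH]; [rewrite !sum_O; apply surjective_pairing|].
    rewrite !sum_Sn, IH; reflexivity. }
  apply filterlim_locally; intro eps.
  generalize (proj1 (filterlim_locally _ _) H1 eps) (proj1 (filterlim_locally _ _) H2 eps).
  intros A B; generalize (filter_and _ _ A B); apply filter_imp; intros n [P Q].
  rewrite E; split; assumption.
Qed.

Lemma pow_n_Cpow (z : C) (n : nat) : @pow_n C_Ring z n = (z ^ n)%C.
Proof. induction n as [|n IH]; simpl; [reflexivity|rewrite IH; reflexivity]. Qed.

Lemma is_pseries_C_real_coef (a : nat -> R) (z l : C) :
  is_series (fun n => a n * Re (z ^ n)%C) (Re l) ->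
  is_series (fun n => a n * Im (z ^ n)%C) (Im l) ->
  @is_pseries C_AbsRing C_NormedModule (fun n => RtoC (a n)) z l.
Proof.
  assert (E : forall n, @scal C_AbsRing C_NormedModule (@pow_n C_Ring z n) (RtoC (a n))
     = (z ^ n * RtoC (a n))%C).
  { intro n; rewrite pow_n_Cpow; reflexivity. }
  intros H1 H2; apply is_series_C.
  - eapply is_series_ext; [|exact H1]; intro n; rewrite E; unfold Re; simpl; ring.
  - eapply is_series_ext; [|exact H2]; intro n; rewrite E; unfold Im; simpl; ring.
Qed.

(** For fixed [z] the kernel is expanded as a pair of real power series in [t], which the functional
    integrates termwise; the powers of [z] sit in the coefficients. *)
Lemma is_pseries_power_moment (m : nat -> R) (sigma : R) (z : C) :
  0 < sigma -> hausdorff m -> Cmod z < 1 ->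
  @is_pseries C_AbsRing C_NormedModule
    (fun n => RtoC (binom_coef sigma n * m n)) z (power_moment m sigma z).
Proof.
  intros Hs Hm Hz.
  destruct (binomial_series_ray sigma z Hs Hz) as (R1 & R2 & E).
  assert (Hslit : slit_plane z).
  { intros [_ H]; generalize (re_le_Cmod z) (Rle_abs (Re z)); lra. }
  destruct (ctame_cpow z (- sigma)) as [T1 T2]; [lra|exact Hslit|].
  assert (X : forall (c : nat -> R) (phi : R -> R), Rbar_lt 1 (CV_radius c) -> tame phi ->
     (forall t, 0 <= t <= 1 -> phi t = PSeries c t) ->
     is_series (fun n => c n * m n) (moment m phi)).
  { intros c phi Hc Hphi Hser.
    apply (is_series_moment m c phi); [exact Hm| | |apply moment_correct; assumption].
    - apply (ex_series_ext (fun n => Rabs (c n * 1 ^ n))).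
      + intro n; rewrite pow1, Rmult_1_r; reflexivity.
      + apply CV_disk_inside; rewrite Rabs_R1; exact Hc.
    - intros t Ht; rewrite (Hser t Ht).
      apply is_pseries_R, PSeries_correct, CV_radius_inside.
      rewrite Rabs_pos_eq by lra.
      apply (Rbar_le_lt_trans t 1); [simpl; lra|exact Hc]. }
  apply is_pseries_C_real_coef.
  - eapply is_series_ext; [|apply (X _ _ R1 T1); intros t Ht; rewrite (E t Ht); reflexivity].
    intro n; simpl; ring.
  - eapply is_series_ext; [|apply (X _ _ R2 T2); intros t Ht; rewrite (E t Ht); reflexivity].
    intro n; simpl; ring.
Qed.

Lemma power_moment_neg_real (m : nat -> R) (sigma x : R) :
  0 < x ->
  power_moment m sigma (RtoC (- x)) = RtoC (moment m (fun t => Rpower (1 + x * t) (- sigma))).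
Proof.
  intro Hx.
  assert (E : forall t, 0 <= t <= 1 ->
     cpow (1 - RtoC (- x) * RtoC t)%C (- sigma) = RtoC (Rpower (1 + x * t) (- sigma))).
  { intros t Ht; rewrite <- cpow_real by nra.
    f_equal; apply injective_projections; simpl; ring. }
  unfold power_moment, cmoment; apply injective_projections; cbn [fst snd RtoC].
  - unfold moment; f_equal; apply Lim_seq_ext; intro N.
    apply bern_ext; intros k Hk; rewrite E by (apply grid_in_unit, Hk); reflexivity.
  - apply is_moment_unique.
    apply (is_moment_ext m (fun _ => 0)).
    + intros t Ht; rewrite E by exact Ht; reflexivity.
    + generalize (is_moment_const m 0); rewrite Rmult_0_l; auto.
Qed.

(** * Hypergeometric functions *)

Lemma hyp_coef_pairs (l : list (R * R)) (n : nat) :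
  hyp_coef (map fst l) (map snd l) n = poch_ratio l n / INR (fact n).
Proof.
  unfold hyp_coef, poch_ratio, Rdiv; rewrite !map_map, Rinv_mult, <- Rmult_assoc; f_equal.
  induction l as [|p l IH]; simpl; [field|].
  rewrite <- IH, Rinv_mult; ring.
Qed.

Lemma hyp_coef_cons_pairs (sigma : R) (l : list (R * R)) (n : nat) :
  hyp_coef (sigma :: map fst l) (map snd l) n = binom_coef sigma n * poch_ratio l n.
Proof.
  transitivity (poch sigma n * hyp_coef (map fst l) (map snd l) n).
  - unfold hyp_coef; simpl; unfold Rdiv; ring.
  - rewrite hyp_coef_pairs; unfold binom_coef, Rdiv; ring.
Qed.

(** Given by its series, which converges on all of C; the identification with a moment of an
    exponential is needed only at negative reals, so no complex exponential kernel appears. *)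
Definition exp_moment_series (m : nat -> R) (z : C) : C :=
  (Series (fun n => m n / INR (fact n) * Re (z ^ n)%C),
   Series (fun n => m n / INR (fact n) * Im (z ^ n)%C)).

Lemma ex_series_exp_abs (x : R) : ex_series (fun n => Rabs x ^ n / INR (fact n)).
Proof.
  exists (exp (Rabs x)).
  eapply is_series_ext; [|apply (proj1 (is_pseries_R _ _ _) (is_exp_Reals (Rabs x)))].
  intro n; simpl; unfold Rdiv; ring.
Qed.

Lemma is_pseries_exp_moment_series (m : nat -> R) (z : C) :
  hausdorff m ->
  @is_pseries C_AbsRing C_NormedModule
    (fun n => RtoC (m n / INR (fact n))) z (exp_moment_series m z).
Proof.
  intro Hm.
  assert (X : forall c : nat -> R, (forall n, Rabs (c n) <= Cmod z ^ n) ->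
     ex_series (fun n => m n / INR (fact n) * c n)).
  { intros c Hc.
    apply (ex_series_le (K := R_AbsRing) (V := R_CompleteNormedModule) _
             (fun n => m 0%nat * (Rabs (Cmod z) ^ n / INR (fact n)))).
    - intro n; change (Rabs (m n / INR (fact n) * c n) <= m 0%nat * (Rabs (Cmod z) ^ n / INR (fact n))).
      assert (P : 0 < / INR (fact n)) by apply Rinv_0_lt_compat, INR_fact_lt_0.
      generalize (hausdorff_ge0 m n Hm) (hausdorff_le0 m n Hm); intros M0 M1.
      rewrite (Rabs_pos_eq (Cmod z)) by apply Cmod_ge_0.
      unfold Rdiv; rewrite !Rabs_mult, (Rabs_pos_eq (m n)), (Rabs_pos_eq (/ _)) by lra.
      replace (m 0%nat * (Cmod z ^ n * / INR (fact n))) with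
        (m 0%nat * / INR (fact n) * Cmod z ^ n) by ring.
      apply Rmult_le_compat; [|apply Rabs_pos| |apply Hc].
      + apply Rmult_le_pos; lra.
      + apply Rmult_le_compat_r; lra.
    - apply (@ex_series_scal R_AbsRing R_NormedModule (m 0%nat)), ex_series_exp_abs. }
  apply is_pseries_C_real_coef; apply Series_correct, X; intro n;
    [apply Re_Cpow_bound|apply Im_Cpow_bound].
Qed.

Lemma RtoC_Cpow (x : R) (n : nat) : (RtoC x ^ n)%C = RtoC (x ^ n).
Proof.
  induction n as [|n IH]; simpl; [reflexivity|].
  rewrite IH, RtoC_mult; reflexivity.
Qed.

Lemma exp_moment_series_neg_real (m : nat -> R) (x : R) :
  hausdorff m -> 0 < x ->
  exp_moment_series m (RtoC (- x)) = RtoC (moment m (fun t => exp (- (x * t)))).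
Proof.
  intros Hm Hx; unfold exp_moment_series; apply injective_projections; simpl.
  - apply is_series_unique.
    apply (is_series_ext (fun n => (- x) ^ n / INR (fact n) * m n)).
    + intro n; rewrite RtoC_Cpow; unfold Rdiv; simpl; ring.
    + apply (is_series_moment m _ (fun t => exp (- (x * t)))); [exact Hm| | |].
      * apply (ex_series_ext (fun n => Rabs (- x) ^ n / INR (fact n))); [|apply ex_series_exp_abs].
        intro n; unfold Rdiv; rewrite Rabs_mult, RPow_abs; f_equal.
        rewrite Rabs_pos_eq; [reflexivity|].
        apply Rlt_le, Rinv_0_lt_compat, INR_fact_lt_0.
      * intros t _.
        replace (- (x * t)) with (- x * t) by ring.
        eapply is_series_ext; [|apply (proj1 (is_pseries_R _ _ _) (is_exp_Reals (- x * t)))].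
        intro n; cbv beta; rewrite Rpow_mult_distr; unfold Rdiv; simpl; ring.
      * apply moment_correct; [exact Hm|].
        apply (tame_kernel _ _ 0 x exp_kernel); lra.
  - apply is_series_unique.
    apply (is_series_ext (fun n => 0)).
    + intro n; rewrite RtoC_Cpow; simpl; ring.
    + change (is_lim_seq (sum_n (fun _ => 0)) 0).
      apply (is_lim_seq_ext (fun _ => 0)); [|apply is_lim_seq_const].
      intro n; symmetry; induction n as [|n IH]; [apply sum_O|].
      rewrite sum_Sn, IH; apply Rplus_0_l.
Qed.

Lemma pFq_neg_completely_monotone_pairs (l : list (R * R)) (sigma : R) :
  0 < sigma ->
  (forall p, In p l -> 0 <= fst p /\ 0 < snd p) ->
  (forall t, 0 < t <= 1 -> 0 <= vpair l t) ->
  pFq_neg_completely_monotone (sigma :: map fst l) (map snd l) /\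
  pFq_neg_completely_monotone (map fst l) (map snd l).
Proof.
  intros Hs Hl Hv; assert (Hm := hausdorff_poch_ratio l Hl Hv); split.
  - exists (power_moment (poch_ratio l) sigma),
      (fun x => moment (poch_ratio l) (fun t => Rpower (1 + x * t) (- sigma))).
    split; [|split].
    + right; split; [simpl; rewrite !length_map; reflexivity|split].
      * intros z Hz; unfold is_hyp_series.
        eapply is_series_ext; [|apply (is_pseries_power_moment _ sigma z Hs Hm Hz)].
        intro n; simpl; rewrite hyp_coef_cons_pairs; reflexivity.
      * intros z Hz; apply ex_derive_power_moment; assumption.
    + intros x Hx; apply power_moment_neg_real, Hx.
    + apply completely_monotone_moment_power; assumption.
  - exists (exp_moment_series (poch_ratio l)),
      (fun x => moment (poch_ratio l) (fun t => exp (- (x * t)))).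
    split; [|split].
    + left; split; [rewrite !length_map; lia|].
      intros z; unfold is_hyp_series.
      eapply is_series_ext; [|apply (is_pseries_exp_moment_series _ z Hm)].
      intro n; simpl; rewrite hyp_coef_pairs; reflexivity.
    + intros x Hx; apply exp_moment_series_neg_real; assumption.
    + apply (completely_monotone_moment_kernel _ _ _ exp_kernel Hm).
Qed.

(** * Weak supermajorization *)

Lemma Rpower_le_1 (t a : R) : 0 < t <= 1 -> 0 <= a -> Rpower t a <= 1.
Proof.
  intros Ht Ha; apply exp_le_1.
  assert (ln t <= 0) by (rewrite <- ln_1; apply ln_le; lra); nra.
Qed.

(** Every [t^a] is at most 1, and all terms [- t^b] but one are dropped. *)
Lemma vpair_le (l : list (R * R)) (p : R * R) (t : R) :
  (forall r, In r l -> 0 <= fst r) -> In p l -> 0 < t <= 1 ->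
  vpair l t <= INR (length l) - Rpower t (snd p).
Proof.
  intros Hl Hp Ht; unfold vpair.
  assert (U : forall l, (forall r, In r l -> 0 <= fst r) ->
    lsum (fun r => Rpower t (fst r) - Rpower t (snd r)) l <= INR (length l)).
  { clear -Ht; induction l as [|r l IH]; intro Hl; [unfold lsum; simpl; lra|].
    rewrite lsum_cons; simpl length; rewrite S_INR.
    specialize (IH (fun s Hs => Hl s (or_intror Hs))).
    generalize (Rpower_le_1 t (fst r) Ht (Hl r (or_introl eq_refl))) (exp_pos (snd r * ln t)).
    change (exp (snd r * ln t)) with (Rpower t (snd r)); lra. }
  induction l as [|r l IH]; [contradiction|].
  rewrite lsum_cons; simpl length; rewrite S_INR.
  generalize (Rpower_le_1 t (fst r) Ht (Hl r (or_introl eq_refl))) (exp_pos (snd r * ln t)).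
  intros P1 P2; change (exp (snd r * ln t)) with (Rpower t (snd r)) in P2.
  destruct Hp as [-> |Hp].
  - specialize (U l (fun s Hs => Hl s (or_intror Hs))); lra.
  - specialize (IH (fun s Hs => Hl s (or_intror Hs)) Hp); lra.
Qed.

Lemma vpair_ge0_snd_ge0 (l : list (R * R)) (p : R * R) :
  (forall r, In r l -> 0 <= fst r) -> (forall t, 0 < t <= 1 -> 0 <= vpair l t) ->
  In p l -> 0 <= snd p.
Proof.
  intros Hl Hv Hp; destruct (Rle_or_lt 0 (snd p)) as [H|H]; [exact H|exfalso].
  (* Chosen so that at [t = exp (- s)] the power [t^b] equals [exp N], with [N] the number of pairs;
     this exceeds [N] and makes [v] negative. *)
  set (s := INR (length l) / - snd p).
  assert (Hs : 0 <= s) by (apply Rdiv_le_0_compat; [apply pos_INR|lra]).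
  assert (Ht : 0 < exp (- s) <= 1) by (split; [apply exp_pos|apply exp_le_1; lra]).
  assert (V := vpair_le l p _ Hl Hp Ht); specialize (Hv _ Ht).
  unfold Rpower in V; rewrite ln_exp in V.
  assert (E : snd p * - s = INR (length l)) by (unfold s; field; lra).
  rewrite E in V; generalize (exp_ineq1_le (INR (length l))); lra.
Qed.

(** Majorization rearranges [A] and [B] independently, which destroys the pairing in [vfun]; the two
    separate sums are invariant. *)
Lemma vfun_split (A B : list R) (t : R) :
  length A = length B -> vfun A B t = lsum (Rpower t) A - lsum (Rpower t) B.
Proof.
  unfold vfun, lsum; revert B; induction A as [|a A IH]; intros [|b B] H;
    try discriminate; simpl; [ring|].
  rewrite IH by (injection H; auto); ring.
Qed.

Lemma lsum_Permutation {T : Type} (f : T -> R) (l l' : list T) :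
  Permutation l l' -> lsum f l = lsum f l'.
Proof.
  induction 1; rewrite ?lsum_cons; try lra; congruence.
Qed.

(* Abel summation; [e] is the surplus of the partial sums of [B] over those of
   [A] accumulated before the present lists, weighted by the slope of
   [b |-> - t^b] at the previous, hence smaller, entry [b0]. *)
Lemma majorization_abel (t : R) (A B : list R) (b0 e : R) :
  0 < t <= 1 -> length A = length B -> Sorted Rle (b0 :: B) -> 0 <= e ->
  (forall k, (1 <= k <= length A)%nat ->
     Rlist_sum (firstn k A) <= e + Rlist_sum (firstn k B)) ->
  0 <= - ln t * Rpower t b0 * e + (lsum (Rpower t) A - lsum (Rpower t) B).
Proof.
  intro Ht.
  assert (HL : ln t <= 0) by (rewrite <- ln_1; apply ln_le; lra).
  revert B b0 e; induction A as [|a A IH]; intros [|b B] b0 e Hlen HB He Hk; try discriminate.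
  - unfold lsum; simpl.
    assert (0 <= - ln t * Rpower t b0 * e); [|lra].
    apply Rmult_le_pos; [apply Rmult_le_pos; [lra|apply Rlt_le, exp_pos]|exact He].
  - inversion HB as [|x y HB' Hd]; subst; inversion Hd; subst.
    assert (He' : 0 <= e + (b - a)).
    { specialize (Hk 1%nat); simpl in Hk; specialize (Hk ltac:(lia)); lra. }
    assert (IH' := IH B b (e + (b - a)) ltac:(injection Hlen; auto) HB' He').
    rewrite !lsum_cons.
    assert (S1 : 0 <= - ln t * Rpower t b * (e + (b - a)) + (lsum (Rpower t) A - lsum (Rpower t) B)).
    { apply IH'; intros k Hk'.
      specialize (Hk (S k)); simpl in Hk; specialize (Hk ltac:(lia)); lra. }
    (* The tangent inequality at [b] for the convex function [x |-> t^x], from [exp x >= 1 + x]. *)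
    assert (S2 : - ln t * Rpower t b * (b - a) <= Rpower t a - Rpower t b).
    { unfold Rpower.
      replace (a * ln t) with (b * ln t + (a - b) * ln t) by ring.
      rewrite exp_plus.
      generalize (exp_ineq1_le ((a - b) * ln t)) (exp_pos (b * ln t)); nra. }
    assert (S3 : Rpower t b <= Rpower t b0) by (apply exp_le; nra).
    assert (S4 : - ln t * Rpower t b * e <= - ln t * Rpower t b0 * e).
    { apply Rmult_le_compat_r; [exact He|]; apply Rmult_le_compat_l; lra. }
    lra.
Qed.

Lemma weak_supermajorization_vfun_ge0 (A B : list R) (t : R) :
  weak_supermajorization B A -> 0 < t <= 1 -> 0 <= vfun A B t.
Proof.
  intros [Hlen (A' & B' & PA & _ & _ & PB & SB & _ & H)] Ht.
  rewrite vfun_split by exact Hlen.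
  rewrite (lsum_Permutation _ _ _ PA), (lsum_Permutation _ _ _ PB).
  assert (Hlen' : length A' = length B').
  { rewrite <- (Permutation_length PA), <- (Permutation_length PB); exact Hlen. }
  rewrite (Permutation_length PA) in H.
  destruct B' as [|b B'].
  - destruct A'; [unfold lsum; simpl; lra|discriminate].
  - assert (M := majorization_abel t A' (b :: B') b 0 Ht Hlen').
    rewrite Rmult_0_r, Rplus_0_l in M; apply M; [|lra|].
    + constructor; [exact SB|constructor; lra].
    + intros k Hk; rewrite Rplus_0_l; apply H, Hk.
Qed.

Lemma map_fst_combine {T U : Type} (l : list T) (l' : list U) :
  length l = length l' -> map fst (combine l l') = l.
Proof.
  revert l'; induction l as [|x l IH]; intros [|y l'] H; try discriminate; simpl; [reflexivity|].
  rewrite IH by (injection H; auto); reflexivity.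
Qed.

Lemma map_snd_combine {T U : Type} (l : list T) (l' : list U) :
  length l = length l' -> map snd (combine l l') = l'.
Proof.
  revert l'; induction l as [|x l IH]; intros [|y l'] H; try discriminate; simpl; [reflexivity|].
  rewrite IH by (injection H; auto); reflexivity.
Qed.

Theorem theorem3 (q : nat) (A B : list R) (sigma : R)
    (hA : length A = q) (hB : length B = q) (hsigma : 0 < sigma) :
  ((* The parameters are admissible: nonnegative upper ones, and lower ones
      outside {0, -1, -2, ...}. *)
   List.Forall (fun a => 0 <= a) A ->
   List.Forall (fun b => forall m : nat, b <> - INR m) B ->
   (forall t : R, 0 < t <= 1 -> 0 <= vfun A B t) ->
   pFq_neg_completely_monotone (sigma :: A) B /\
   pFq_neg_completely_monotone A B)
  /\
  (weak_supermajorization B A ->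
   pFq_neg_completely_monotone (sigma :: A) B /\
   pFq_neg_completely_monotone A B).
Proof.
  assert (Hlen : length A = length B) by congruence.
  assert (Main : List.Forall (fun a => 0 <= a) A ->
   List.Forall (fun b => forall m : nat, b <> - INR m) B ->
   (forall t : R, 0 < t <= 1 -> 0 <= vfun A B t) ->
   pFq_neg_completely_monotone (sigma :: A) B /\
   pFq_neg_completely_monotone A B).
  { intros HA HB Hv; rewrite Forall_forall in HA, HB.
    change (forall t, 0 < t <= 1 -> 0 <= vpair (combine A B) t) in Hv.
    assert (Hl : forall p, In p (combine A B) -> 0 <= fst p)
      by (intros [a b] Hp; apply HA, (in_combine_l A B a b Hp)).
    assert (P := pFq_neg_completely_monotone_pairs (combine A B) sigma hsigma).
    rewrite map_fst_combine, map_snd_combine in P by exact Hlen.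
    apply P; [|exact Hv]; intros p Hp; split; [apply Hl, Hp|].
    (* Nonnegativity of [v] gives [b >= 0]; the value 0 is excluded by admissibility with
       [m = 0]. *)
    destruct (vpair_ge0_snd_ge0 _ p Hl Hv Hp) as [H|H]; [exact H|exfalso].
    destruct p as [a b]; apply (HB b (in_combine_r A B a b Hp) 0%nat); simpl in *; lra. }
  split; [exact Main|].
  intro H; assert (Hv := fun t => weak_supermajorization_vfun_ge0 A B t H).
  destruct H as [_ (A' & B' & PA & _ & HA & PB & _ & HB & _)].
  rewrite Forall_forall in HA, HB; apply Main; [| |exact Hv]; apply Forall_forall.
  - intros a Ha; apply Rlt_le, HA, (Permutation_in a PA Ha).
  - intros b Hb m; generalize (HB b (Permutation_in b PB Hb)) (pos_INR m); lra.
Qed.
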